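(* Let $a_1,\ldots,a_r\in\mathbb{Q}$. There exist a finite Galois extension $L/\mathbb{Q}$ and nonzero Galois conjugate elements $\theta_1,\ldots,\theta_r\in L$ (i.e. lying in a single $\mathrm{Gal}(L/\mathbb{Q})$-orbit, not necessarily distinct) satisfying $\sum_{i=1}^r a_i\theta_i=0$ if and only if: (i) for every prime $p$ and every $i$, $|a_i|_p\le\max_{j\ne i}|a_j|_p$; (ii) for every $i$, $|a_i|\le\sum_{j\ne i}|a_j|$ in the real absolute value.
   Context: $|\cdot|_p$ is the $p$-adic absolute value on $\mathbb{Q}$. *)

(* Defs.v *)
From mathcomp Require Import all_boot all_order all_algebra all_fingroup all_field.

Set Implicit Arguments.
Unset Strict Implicit.
Unset Printing Implicit Defensive.

Import Order.TTheory GRing.Theory Num.Theory.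

Local Open Scope ring_scope.

(* Since x is in lowest terms, at most one of the two terms is nonzero. The
   value at x = 0 is 0 here, and is not used by padic_abs. *)
Definition padic_val (p : nat) (x : rat) : int :=
  (logn p `|numq x|)%:Z - (logn p `|denq x|)%:Z.

Definition padic_abs (p : nat) (x : rat) : rat :=
  if x == 0 then 0 else p%:R ^ (- padic_val p x).

Definition galois_conjugates (L : splittingFieldType rat) (r : nat)
    (theta : 'I_r -> L) : Prop :=
  exists t : L, forall i : 'I_r,
    exists2 s : gal_of {:L}, s \in 'Gal({:L} / 1)%g & theta i = s t.

(* The families compared with |a_i| consist of nonnegative numbers, so that
   starting the maximum at 0 only matters when r = 1, where it gives the usual
   convention that an empty maximum of absolute values is 0. *)
Definition padic_condition (r : nat) (a : 'I_r -> rat) : Prop :=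
  forall p : nat, prime p -> forall i : 'I_r,
    padic_abs p (a i) <= \big[Num.max/0]_(j < r | j != i) padic_abs p (a j).

Definition real_condition (r : nat) (a : 'I_r -> rat) : Prop :=
  forall i : 'I_r, `|a i| <= \sum_(j < r | j != i) `|a j|.

(* Main.v *)
(* Expressing the theta_i in terms of the conjugates of one element, a relation
   amounts to permutations s_i of a finite set and a nonzero rational function x
   on it with sum_i a_i x(s_i k) = 0 for all k.  Necessity: look at a point where
   |x|, real or p-adic, is maximal.

   Sufficiency.  It is enough to find a finite multiset of integral points y of
   the hyperplane sum_i a_i y_i = 0, not all zero, such that every coordinate y_i
   takes each value equally often: listing the multiset, the coordinates are
   rearrangements of each other.  The strict polygon inequality provides a
   positive definite quadratic form q on the hyperplane for which all coordinate
   functionals have dual norm 1.  Give the lattice point y the weight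
   max(0, R^2 - q(y))^n.  The reflection exchanging two coordinate functionals
   preserves q, though not the lattice; as the p-adic conditions make each
   coordinate map onto Z, and as the weight is smooth, the distributions of two
   coordinates nevertheless agree up to an error of lower order in R.  By the
   strict polygon inequality, integral points with one large coordinate move the
   error to values of bounded size, at a cost polynomial in R with exponent
   independent of n.  The remaining bounded error is a combination of finitely
   many lattice points, whose weight R^(2n) dominates it when n and R are large.
   When the polygon inequality is an equality, signs and a transposition do.

   Finally, permutations and x are turned into conjugates in a field with Galois
   group S_p and roots alpha_k, through the element sum_k x(k) alpha_k. *)

Require Import Defs.
From HB Require Import structures.
From mathcomp Require Import finmap boolp classical_sets fsbigop.
From mathcomp Require Import all_boot all_order all_algebra all_fingroup all_field.
From mathcomp Require Import ring lra zify.

Set Implicit Arguments.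
Unset Strict Implicit.
Unset Printing Implicit Defensive.

Import Order.TTheory GRing.Theory Num.Theory.

Local Open Scope ring_scope.

(** * Finite differences of a truncated power of a quadratic form *)

Definition fdiff (g : nat -> rat) (i : nat) : rat := g i.+1 - g i.

Lemma eq_iter_fdiff e (g h : nat -> rat) k :
  (forall i, (i <= e + k)%N -> g i = h i) ->
  forall i, (i <= k)%N -> iter e fdiff g i = iter e fdiff h i.
Proof.
elim: e k => [|e IHe] k eq_gh i le_ik; first exact: eq_gh.
have IH j : (j <= k.+1)%N -> iter e fdiff g j = iter e fdiff h j.
  by apply: IHe => l le_l; apply: eq_gh; rewrite addSnnS.
by rewrite !iterS /fdiff !IH // ltnW.
Qed.

Lemma iter_fdiffD e (g h : nat -> rat) i :
  iter e fdiff (fun j => g j + h j) i = iter e fdiff g i + iter e fdiff h i.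
Proof.
elim: e i => [//|e IHe] i; rewrite !iterS /fdiff !IHe; ring.
Qed.

Lemma iter_fdiff_shift e (g : nat -> rat) i :
  iter e fdiff (fun j => g j.+1) i = iter e fdiff g i.+1.
Proof. by elim: e i => [//|e IHe] i; rewrite !iterS /fdiff !IHe. Qed.

Lemma iter_fdiff0 e (g : nat -> rat) i :
  (forall i, g i = 0) -> iter e fdiff g i = 0.
Proof. by move=> g0; elim: e i => [//|e IHe] i; rewrite iterS /fdiff !IHe subr0. Qed.

Lemma iter_fdiff_bound e (g : nat -> rat) C k :
  (forall i, (i <= e + k)%N -> `|g i| <= C) ->
  forall i, (i <= k)%N -> `|iter e fdiff g i| <= 2 ^+ e * C.
Proof.
elim: e k => [|e IHe] k g_le i le_ik; first by rewrite expr0 mul1r; apply: g_le.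
have IH j : (j <= k.+1)%N -> `|iter e fdiff g j| <= 2 ^+ e * C.
  by apply: IHe => l le_l; apply: g_le; rewrite addSnnS.
rewrite iterS /fdiff (le_trans (ler_normB _ _)) // exprS.
have := IH i.+1 le_ik; have := IH i (leqW le_ik); lra.
Qed.

(** A discrete bound of class [C^e] at scale [R]: each further difference gains a factor [1 / R].
    The constraint [j + i <= e] involves only the nodes [0, ..., e], since the quadratic function
    used below is controlled only there. *)
Definition smooth_bound e (C R : rat) (g : nat -> rat) :=
  forall j i, (j + i <= e)%N -> `|iter j fdiff g i| * R ^+ j <= C.

Lemma smooth_bound_fdiff e C R g : 0 < R ->
  smooth_bound e.+1 C R g -> smooth_bound e (C / R) R (fdiff g).
Proof.
move=> R0 g_bd j i le_ji; rewrite -iterSr ler_pdivlMr // -mulrA -exprSr.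
by apply: g_bd.
Qed.

Lemma smooth_bound_shift e C R g :
  smooth_bound e.+1 C R g -> smooth_bound e C R (fun i => g i.+1).
Proof.
by move=> g_bd j i le_ji; rewrite iter_fdiff_shift; apply: g_bd; rewrite addnS.
Qed.

Lemma smooth_bound_leq e e' C R g : (e' <= e)%N ->
  smooth_bound e C R g -> smooth_bound e' C R g.
Proof. by move=> le_e g_bd j i le_ji; apply: g_bd; apply: leq_trans le_e. Qed.

(** Discrete Leibniz rule, by induction on the order: differencing one factor divides its constant
    by [R], and each order doubles the number of terms. *)
Lemma smooth_boundM_aux e C C' R g h j i : 0 < R -> (j + i <= e)%N ->
    smooth_bound e C R g -> smooth_bound e C' R h ->
  `|iter j fdiff (fun i => g i * h i) i| * R ^+ j <= 2 ^+ j * (C * C').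
Proof.
move=> R0; elim: j e C C' g h i => [|j IHj] e C C' g h i le_ji g_bd h_bd.
  rewrite !expr0 mulr1 mul1r /= normrM.
  have := g_bd 0 i le_ji; have := h_bd 0 i le_ji.
  by rewrite !expr0 !mulr1 => h_le g_le; apply: ler_pM.
case: e le_ji g_bd h_bd => // e le_ji g_bd h_bd.
rewrite iterSr (@eq_iter_fdiff _ _ (fun i => fdiff g i * h i.+1 + g i * fdiff h i) i) //;
  last by move=> l _; rewrite /fdiff; ring.
rewrite iter_fdiffD.
have := IHj e (C / R) C' (fdiff g) (fun i => h i.+1) i le_ji
   (smooth_bound_fdiff R0 g_bd) (smooth_bound_shift h_bd).
have := IHj e C (C' / R) g (fdiff h) i le_ji
   (smooth_bound_leq (leqnSn e) g_bd) (smooth_bound_fdiff R0 h_bd).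
rewrite !exprS.
have le3 := ler_normD (iter j fdiff (fun i => fdiff g i * h i.+1) i)
  (iter j fdiff (fun i => g i * fdiff h i) i).
move: le3; set G := `|iter j _ _ i|; set H := `|iter j _ _ i| => le3 le1 le2.
have E : C * C' = C * C' / R * R by rewrite divfK // gt_eqF.
have le4 : (G + H) * R ^+ j <= 2 * 2 ^+ j * (C * C' / R).
  have -> : 2 * 2 ^+ j * (C * C' / R) = 2 ^+ j * (C * (C' / R)) + 2 ^+ j * (C / R * C').
    by ring.
  by rewrite mulrDl; lra.
rewrite E [X in _ <= X]mulrA [R * _]mulrC [X in X <= _]mulrA ler_pM2r //.
by apply: le_trans le4; rewrite ler_pM2r // exprn_gt0.
Qed.

Lemma smooth_boundM e C C' R g h : 0 < R ->
    smooth_bound e C R g -> smooth_bound e C' R h ->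
  smooth_bound e (2 ^+ e * (C * C')) R (fun i => g i * h i).
Proof.
move=> R0 g_bd h_bd j i le_ji; apply: le_trans (smooth_boundM_aux R0 le_ji g_bd h_bd) _.
have C0 : 0 <= C by have := g_bd 0 0 isT; rewrite expr0 mulr1; apply: le_trans.
have C'0 : 0 <= C' by have := h_bd 0 0 isT; rewrite expr0 mulr1; apply: le_trans.
apply: ler_wpM2r; first exact: mulr_ge0.
by apply: ler_weXn2l => //; apply: leq_trans le_ji; apply: leq_addr.
Qed.

Lemma smooth_boundX e C R g n : 0 < R ->
  smooth_bound e C R g -> smooth_bound e ((2 ^+ e * C) ^+ n) R (fun i => g i ^+ n).
Proof.
move=> R0 g_bd; elim: n => [|n IHn] j i le_ji.
  rewrite expr0; case: j le_ji => [|j] _; first by rewrite mulr1 /= normr1.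
  rewrite iterSr iter_fdiff0 ?normr0 ?mul0r ?ler01 //.
have -> : iter j fdiff (fun i => g i ^+ n.+1) i = iter j fdiff (fun i => g i * g i ^+ n) i.
  by apply: (@eq_iter_fdiff _ _ _ i) => // l _; rewrite exprS.
by rewrite exprS -mulrA; apply: (smooth_boundM R0 g_bd IHn).
Qed.

Section Cutoff.

Variables (V : lmodType rat) (B : V -> V -> rat).
Hypothesis BDl : forall x y z, B (x + y) z = B x z + B y z.
Hypothesis BZl : forall c x z, B (c *: x) z = c * B x z.
Hypothesis BC : forall x y, B x y = B y x.
Hypothesis B_ge0 : forall x, 0 <= B x x.

Lemma form_addsq x y : B (x + y) (x + y) = B x x + 2 * B x y + B y y.
Proof. by rewrite BDl ![B _ (x + y)]BC !BDl [B y x]BC; ring. Qed.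

(** The form is assumed only semidefinite. If [B y y = 0], its value at [x + c *: y] is affine in
    [c] and nonnegative, which forces [B x y = 0]; otherwise the minimum over [c] is used. *)
Lemma form_Cauchy_Schwarz x y : B x y ^+ 2 <= B x x * B y y.
Proof.
have := B_ge0 y; rewrite le_eqVlt => /orP[/eqP y0|y_gt0].
  have H c : 0 <= B x x + 2 * c * B x y.
    have := B_ge0 (x + c *: y); rewrite form_addsq.
    by rewrite ![B _ (c *: y)]BC !BZl ![B y (c *: _)]BC BZl -y0 [B y x]BC; lra.
  rewrite -y0 mulr0; have [->|nz] := eqVneq (B x y) 0; first by rewrite expr0n.
  have := H (- (B x x + 1) / (2 * B x y)).
  have -> : 2 * (- (B x x + 1) / (2 * B x y)) * B x y = - (B x x + 1) by field.
  lra.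
have := B_ge0 (x + (- (B x y / B y y)) *: y); rewrite form_addsq.
rewrite ![B _ (_ *: y)]BC !BZl ![B y (_ *: _)]BC BZl [B y x]BC.
have nz : B y y != 0 by rewrite gt_eqF.
have -> : B x x + 2 * (- (B x y / B y y) * B x y) +
  - (B x y / B y y) * (- (B x y / B y y) * B y y) =
  (B x x * B y y - B x y ^+ 2) / B y y by field.
by rewrite pmulr_lge0 ?invr_gt0 // subr_ge0.
Qed.

Definition cutoff (n R : nat) (y : V) : rat :=
  Num.max 0 (R%:R ^+ 2 - B y y) ^+ n.

Lemma cutoff_ge0 n R y : 0 <= cutoff n R y.
Proof. by rewrite exprn_ge0 // le_max lexx. Qed.

Lemma cutoff_neq0 n R y : cutoff n.+1 R y != 0 -> B y y < R%:R ^+ 2.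
Proof.
apply: contraNT; rewrite -leNgt => le_R; rewrite /cutoff.
by rewrite (_ : Num.max _ _ = 0) ?expr0n //; apply/max_idPl; lra.
Qed.

(** The weight has size [R^(2(n+1))], and each difference gains a factor [R]. Let [u i] be the
    function under the power, before truncation, at the node [i]. If all [u i] are negative the
    weight vanishes; if all are nonnegative it is a power of a quadratic polynomial; if the signs
    are mixed, [u] is at most of order [R] and no cancellation is necessary. *)
Lemma cutoff_smooth n (c : V) : exists2 C, 0 <= C & forall (R : nat) y, (0 < R)%N ->
  `|iter n.+1 fdiff (fun i => cutoff n.+1 R (y + c *+ i)) 0| <= C * R%:R ^+ n.+1.
Proof.
pose b := B c c; have b0 : 0 <= b := B_ge0 c.
pose N : rat := n.+1%:R; have N0 : 0 <= N by rewrite ler0n.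
(* [K * r] bounds the steps of [u] once some node [i0] has [u i0 >= 0]: Cauchy-Schwarz gives
   [r * (1 + b)] for the mixed term there, and moving to another node adds at most [N * b]. *)
pose K : rat := 2 * ((1 + b) * (1 + N)) + b.
have K0 : 0 <= K by rewrite /K; nra.
pose C0 : rat := 1 + K + 2 * b.
pose C1 : rat := (2 ^+ n.+1 * C0) ^+ n.+1.
pose C2 : rat := 2 ^+ n.+1 * (N * K) ^+ n.+1.
have C00 : 0 <= C0 by rewrite /C0; lra.
have C10 : 0 <= C1 by rewrite exprn_ge0 // mulr_ge0 // exprn_ge0.
have C20 : 0 <= C2 by rewrite mulr_ge0 ?exprn_ge0 // mulr_ge0.
exists (C1 + C2) => [|R y R_gt0]; first exact: addr_ge0.
set r : rat := R%:R; have r1 : 1 <= r by rewrite ler1n.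
have r0 : 0 < r by lra.
pose u i := r ^+ 2 - B (y + c *+ i) (y + c *+ i).
have duE i : u i.+1 - u i = - (2 * B (y + c *+ i) c + b).
  by rewrite /u mulrSr addrA form_addsq /b; ring.
have BcS i j : B (y + c *+ (i + j)) c = B (y + c *+ i) c + j%:R * b.
  by rewrite mulrnDr addrA BDl -[c *+ j]scaler_nat BZl.
have Bc_small i : 0 <= u i -> `|B (y + c *+ i) c| <= r * (1 + b).
  move=> ui; have rb0 : 0 <= r * (1 + b) by apply: mulr_ge0; lra.
  rewrite -(@ler_pXn2r _ 2) ?nnegrE ?normr_ge0 //.
  rewrite real_normK ?num_real //; apply: le_trans (form_Cauchy_Schwarz _ _) _; rewrite -/b.
  apply: (@le_trans _ _ (r ^+ 2 * b)); first by apply: ler_wpM2r => //; rewrite -subr_ge0.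
  by rewrite exprMn; apply: ler_wpM2l; [exact: sqr_ge0 | nra].
have Bc_bd i0 i : (i0 <= n.+1)%N -> 0 <= u i0 -> (i <= n.+1)%N ->
    `|B (y + c *+ i) c| <= r * (1 + b) + N * b.
  move=> le_i0 u0 le_i; have := Bc_small i0 u0; have [le_ii|lt_ii] := leqP i0 i.
    have := BcS i0 (i - i0)%N; rewrite subnKC // => ->.
    have : ((i - i0)%N%:R : rat) <= N by rewrite ler_nat (leq_trans (leq_subr _ _)).
    by have := ler0n rat (i - i0)%N; rewrite !ler_norml => h1 h2 /andP[h3 h4]; nra.
  have := BcS i (i0 - i)%N; rewrite subnKC ?(ltnW lt_ii) // => ->.
  have : ((i0 - i)%N%:R : rat) <= N by rewrite ler_nat (leq_trans (leq_subr _ _)).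
  by have := ler0n rat (i0 - i)%N; rewrite !ler_norml => h1 h2 /andP[h3 h4]; nra.
have du_bd i0 i : (i0 <= n.+1)%N -> 0 <= u i0 -> (i <= n.+1)%N -> `|u i.+1 - u i| <= K * r.
  move=> le_i0 u0 le_i; have := Bc_bd i0 i le_i0 u0 le_i; rewrite duE /K !ler_norml.
  have e1 : N * b <= N * ((1 + b) * r) by apply: ler_wpM2l => //; nra.
  have e2 : b <= b * r by nra.
  have -> : (2 * ((1 + b) * (1 + N)) + b) * r =
    2 * (r * (1 + b) + N * ((1 + b) * r)) + b * r by ring.
  by move=> /andP[h1 h2]; lra.
have phiE i : cutoff n.+1 R (y + c *+ i) = Num.max 0 (u i) ^+ n.+1 by [].
have r1n : 1 <= r ^+ n.+1 by rewrite exprn_ege1.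
have [neg|] := boolP [forall i : 'I_n.+2, u i < 0].
  rewrite (@eq_iter_fdiff _ _ (fun=> 0) 0) // => [|i le_i].
    rewrite iter_fdiff0 // normr0; apply: mulr_ge0; first exact: addr_ge0.
    by apply: exprn_ge0; apply: ltW.
  have lt_i : (i < n.+2)%N by rewrite addn0 in le_i.
  have := forallP neg (Ordinal lt_i) => /= ui.
  by rewrite phiE (_ : Num.max _ _ = 0) ?expr0n //; apply/max_idPl/ltW.
rewrite negb_forall => /existsP[[i0 lt_i0]]; rewrite -leNgt -[nat_of_ord _]/i0 => u_i0.
have du i (le_i : (i <= n.+1)%N) := du_bd i0 i lt_i0 u_i0 le_i.
have [pos|] := boolP [forall i : 'I_n.+2, 0 <= u i].
  have u_ge0 i : (i <= n.+1)%N -> 0 <= u i.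
    by move=> le_i; have := forallP pos (Ordinal (le_i : (i < n.+2)%N)).
  rewrite (@eq_iter_fdiff _ _ (fun i => u i ^+ n.+1) 0) // => [|i le_i]; last first.
    by rewrite phiE; congr (_ ^+ _); apply/max_idPr/u_ge0; rewrite addn0 in le_i.
  have d2u i : iter 2 fdiff u i = - 2 * b.
    by have := BcS i 1%N; rewrite addn1 /= /fdiff !duE => ->; ring.
  have sm : smooth_bound n.+1 (C0 * r ^+ 2) r u.
    move=> [|[|[|j]]] i le_ji.
    - rewrite expr0 mulr1 /= ger0_norm ?u_ge0 // /u.
      by have := B_ge0 (y + c *+ i); rewrite /C0; nra.
    - rewrite expr1 /= /fdiff; have := du i (leqW le_ji); rewrite /C0.
      by have := normr_ge0 (u i.+1 - u i); nra.
    - rewrite d2u normrM normrN ger0_norm // ger0_norm // /C0.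
      by rewrite ler_wpM2r ?exprn_ge0 ?ltW //; lra.
    rewrite -(addn2 j.+1) iterD iterSr iter_fdiff0 ?normr0 ?mul0r; last first.
      by move=> l; rewrite /fdiff !d2u subrr.
    by rewrite mulr_ge0 ?exprn_ge0 // ltW.
  have le_n : (n.+1 + 0 <= n.+1)%N by rewrite addn0.
  have := smooth_boundX n.+1 r0 sm le_n.
  have -> : (2 ^+ n.+1 * (C0 * r ^+ 2)) ^+ n.+1 = C1 * r ^+ n.+1 * r ^+ n.+1.
    by rewrite mulrA exprMn -/C1 exprMn mulrA.
  move=> H.
  rewrite -(@ler_pM2r _ (r ^+ n.+1)) ?exprn_gt0 //.
  apply: le_trans H _.
  by rewrite ler_pM2r ?exprn_gt0 // ler_pM2r ?exprn_gt0 // lerDl.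
rewrite negb_forall => /existsP[[i1 lt_i1]]; rewrite -ltNge -[nat_of_ord _]/i1 => u_i1.
(* Mixed signs: starting from the node where [u] is negative, steps of size at most [K * r] keep [u]
   below [N * K * r]. *)
have uD i j : (i + j <= n.+1)%N -> `|u (i + j)%N - u i| <= j%:R * (K * r).
  elim: j => [|j IHj] le_ij; first by rewrite addn0 subrr normr0 mul0r.
  have le_ij' : (i + j <= n.+1)%N by rewrite addnS in le_ij; apply: ltnW.
  have := IHj le_ij'; have := du _ le_ij'.
  by rewrite addnS -natr1 !ler_norml => /andP[h1 h2] /andP[h3 h4]; apply/andP; split; lra.
have u_le i : (i <= n.+1)%N -> u i <= N * K * r.
  move=> le_i; have KR0 : 0 <= K * r by rewrite mulr_ge0 // ltW.
  have [le_ii|lt_ii] := leqP i1 i.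
    have := uD i1 (i - i1)%N; rewrite subnKC // => /(_ le_i).
    have : ((i - i1)%N%:R : rat) <= N by rewrite ler_nat (leq_trans (leq_subr _ _)).
    by rewrite ler_norml => h1 /andP[h2 h3]; nra.
  have := uD i (i1 - i)%N; rewrite subnKC ?(ltnW lt_ii) // => /(_ lt_i1).
  have : ((i1 - i)%N%:R : rat) <= N by rewrite ler_nat (leq_trans (leq_subr _ _)).
  by rewrite ler_norml => h1 /andP[h2 h3]; nra.
apply: (@le_trans _ _ (C2 * r ^+ n.+1)); last first.
  by rewrite ler_pM2r ?exprn_gt0 // lerDr.
rewrite /C2 -mulrA -exprMn.
apply: (@iter_fdiff_bound n.+1 _ _ 0) => // i; rewrite addn0 => le_i.
have m0 : 0 <= Num.max 0 (u i) by rewrite le_max lexx.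
have NKr0 : 0 <= N * K * r by apply: mulr_ge0; [exact: mulr_ge0 | exact: ltW].
rewrite phiE normrX (ger0_norm m0); apply: lerXn2r; rewrite ?nnegrE //.
by rewrite ge_max NKr0 u_le.
Qed.

End Cutoff.

(** * Slice sums over a lattice *)

(** Summing over the whole type lets translations and reflections reindex without tracking boxes; a
    list covering the support is chosen only when a sum is estimated or split. *)
Definition fsum (T : choiceType) (g : T -> rat) : rat := \sum_(y \in [set: T]) g y.

Lemma fsumE (T : choiceType) (s : seq T) (g : T -> rat) :
  uniq s -> (forall y, g y != 0 -> y \in s) -> fsum g = \sum_(y <- s) g y.
Proof.
move=> s_uniq s_cover; rewrite /fsum (fsbigTE [fset y in s]%fset) => [|y].
  by apply: perm_big; apply: uniq_perm => // y; rewrite ?fset_uniq // in_fsetE.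
by rewrite in_fsetE; apply: contraNeq; apply: s_cover.
Qed.

Lemma eq_fsum (T : choiceType) (g h : T -> rat) : g =1 h -> fsum g = fsum h.
Proof. by move=> eq_gh; apply: eq_fsbigr => y _; apply: eq_gh. Qed.

Lemma fsum_reindex (T U : choiceType) (e : T -> U) (e' : U -> T) (g : U -> rat) :
  cancel e e' -> cancel e' e -> fsum (fun y => g (e y)) = fsum g.
Proof.
by move=> eK e'K; symmetry; apply: reindex_fsbigT; exists e'.
Qed.

Section Grid.

Variable m : nat.
Local Notation V := 'rV[rat]_m.

Definition int_row (y : V) : bool := [forall j, y 0 j \is a Num.int].

(** The points of [(1/D) Z^m] in the box [[-N, N]^m]. *)
Definition grid (D N : nat) : seq V :=
  [seq \row_j ((z j)%:R / D%:R - N%:R) | z : {ffun 'I_m -> 'I_(2 * D * N).+1}].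

Lemma size_grid D N : size (grid D N) = ((2 * D * N).+1 ^ m)%N.
Proof. by rewrite size_map -cardT card_ffun !card_ord. Qed.

Lemma grid_uniq D N : (0 < D)%N -> uniq (grid D N).
Proof.
move=> D_gt0; rewrite map_inj_uniq ?enum_uniq // => z z' /rowP eq_z.
apply/ffunP => j; apply/val_inj/eqP; have /eqP := eq_z j; rewrite !mxE.
rewrite (inj_eq (addIr _)) (inj_eq (mulIf _)) ?eqr_nat //.
by rewrite invr_eq0 pnatr_eq0 -lt0n.
Qed.

Lemma mem_grid D N y : (0 < D)%N -> int_row (D%:R *: y) ->
  (forall j, `|y 0 j| <= N%:R) -> y \in grid D N.
Proof.
move=> D_gt0 /forallP y_int y_le.
have D0 : (0 : rat) < D%:R by rewrite ltr0n.
have zP j : exists z : 'I_(2 * D * N).+1, (z%:R : rat) == D%:R * (y 0 j + N%:R).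
  have : D%:R * (y 0 j + N%:R) \is a Num.nat.
    rewrite natrEint; apply/andP; split.
      have := y_int j; rewrite mxE mulrDr => yj.
      by rewrite rpredD // -natrM natr_int.
    have := y_le j; rewrite ler_norml => /andP[yl _].
    by rewrite pmulr_rge0 //; lra.
  case/natrP=> z Dz; have lt_z : (z < (2 * D * N).+1)%N.
    rewrite ltnS -(ler_nat rat) -Dz !natrM; have := y_le j; rewrite ler_norml => /andP[_ yl].
    by nra.
  by exists (Ordinal lt_z); apply/eqP.
pose z := [ffun j => xchoose (zP j)].
apply/mapP; exists z; rewrite ?mem_enum //; apply/rowP => j; rewrite mxE ffunE.
by rewrite (eqP (xchooseP (zP j))) mulrC mulKf ?gt_eqF //; ring.
Qed.

End Grid.

Lemma iter_fdiff_sum e (T : Type) (s : seq T) (g : T -> nat -> rat) i :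
  iter e fdiff (fun i => \sum_(y <- s) g y i) i = \sum_(y <- s) iter e fdiff (g y) i.
Proof.
elim: e i => [//|e IHe] i; rewrite iterS /fdiff !IHe -sumrB.
by apply: eq_bigr => y _; rewrite iterS.
Qed.

Lemma iter_fdiffM e (g : nat -> rat) a i :
  iter e fdiff (fun i => a * g i) i = a * iter e fdiff g i.
Proof. elim: e i => [//|e IHe] i; rewrite !iterS /fdiff !IHe; ring. Qed.

Lemma iter_fdiff_shiftn e (g : nat -> rat) k i :
  iter e fdiff (fun j => g (k + j)%N) i = iter e fdiff g (k + i)%N.
Proof. by elim: e i => [//|e IHe] i; rewrite !iterS /fdiff !IHe addnS. Qed.

Definition periodic (D : nat) (g : nat -> rat) := forall i, g (D + i)%N = g i.

Lemma periodic_fdiff D e g : periodic D g -> periodic D (iter e fdiff g).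
Proof.
move=> gP; elim: e => [//|e IHe] i.
by rewrite iterS /fdiff -addnS !IHe.
Qed.

Lemma periodic_mod D g i : periodic D g -> g i = g (i %% D)%N.
Proof.
move=> gP; rewrite {1}(divn_eq i D); elim: (i %/ D)%N => [|q IHq]; first by rewrite mul0n.
by rewrite mulSn -addnA gP IHq.
Qed.

Lemma sum_fdiff g D i : \sum_(j < D) fdiff g (i + j)%N = g (i + D)%N - g i.
Proof.
elim: D => [|D IHD]; first by rewrite big_ord0 addn0 subrr.
by rewrite big_ord_recr /= IHD /fdiff addnS; ring.
Qed.

(* The differences of a periodic function sum to zero over a period, hence they
   take both signs and are controlled by the second differences. *)
Lemma periodic_fdiff_bound D (g : nat -> rat) E :
  (0 < D)%N -> periodic D g -> (forall i, `|iter 2 fdiff g i| <= E) ->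
  forall i, `|fdiff g i| <= D%:R * E.
Proof.
move=> D_gt0 gP g_bd i.
have E0 : 0 <= E by apply: le_trans (g_bd 0).
have near j : `|fdiff g (i + j)%N - fdiff g i| <= j%:R * E.
  elim: j => [|j IHj]; first by rewrite addn0 subrr normr0 mul0r.
  have := g_bd (i + j)%N; rewrite addnS -natr1 /= -[fdiff _ _]/(_ (i + j).+1 - _).
  by move: IHj; rewrite !ler_norml => /andP[h1 h2] /andP[h3 h4]; apply/andP; split; lra.
have D0 : (0 : rat) < D%:R by rewrite ltr0n.
have sum0 : \sum_(j < D) fdiff g (i + j)%N = 0 by rewrite sum_fdiff addnC gP subrr.
have near' (j : 'I_D) : `|fdiff g (i + j)%N - fdiff g i| <= D%:R * E.
  by apply: le_trans (near j) _; rewrite ler_wpM2r // ler_nat ltnW.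
have le1 : \sum_(j < D) (fdiff g i - D%:R * E) <= \sum_(j < D) fdiff g (i + j)%N.
  by apply: ler_sum => j _; have := near' j; rewrite ler_norml; lra.
have le2 : \sum_(j < D) fdiff g (i + j)%N <= \sum_(j < D) (fdiff g i + D%:R * E).
  by apply: ler_sum => j _; have := near' j; rewrite ler_norml; lra.
move: le1 le2; rewrite sum0.
rewrite !sumr_const card_ord pmulrn_lge0 ?pmulrn_lle0 // => h1 h2.
by rewrite ler_norml; apply/andP; split; move: h1 h2; set x := fdiff g i; set y := _ * E; lra.
Qed.

(** Each descent by one order costs only a factor [D], so for a periodic function smoothness of high
    order makes the first difference small. *)
Lemma periodic_iter_bound D n (g : nat -> rat) E :
  (0 < D)%N -> periodic D g -> (forall i, `|iter n.+1 fdiff g i| <= E) ->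
  forall i, `|fdiff g i| <= D%:R ^+ n * E.
Proof.
move=> D_gt0; elim: n g E => [|n IHn] g E gP g_bd i; first by rewrite expr0 mul1r.
have gP' : periodic D (fdiff g) := @periodic_fdiff D 1 g gP.
rewrite exprSr -mulrA; rewrite mulrCA; apply: periodic_fdiff_bound => // {}i.
by apply: (IHn (fdiff g)) => // j; rewrite -iterSr.
Qed.

(** * Slice sums depend little on the centre of the weight *)

Section Slices.

Variables (m : nat).
Local Notation V := 'rV[rat]_m.
Variables (B : V -> V -> rat) (Lam : {pred V}).
Hypothesis BDl : forall x y z, B (x + y) z = B x z + B y z.
Hypothesis BZl : forall c x z, B (c *: x) z = c * B x z.
Hypothesis BC : forall x y, B x y = B y x.
Hypothesis B_ge0 : forall x, 0 <= B x x.
Hypothesis B_coord : forall (x : V) (j : 'I_m), x 0 j ^+ 2 <= B x x.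
Hypothesis Lam_zmod : zmod_closed Lam.
Hypothesis Lam_int : {subset Lam <= @int_row m}.
Variable n : nat.

Lemma LamD x y : x \in Lam -> y \in Lam -> x + y \in Lam.
Proof.
move=> xL yL; have [L0 LB] := Lam_zmod.
by rewrite -[y]opprK; apply: (LB) => //; rewrite -sub0r; apply: LB.
Qed.

Lemma LamDr x y : y \in Lam -> (x + y \in Lam) = (x \in Lam).
Proof.
move=> yL; apply/idP/idP => [xyL|xL]; last exact: LamD.
by have := Lam_zmod.2 _ _ xyL yL; rewrite addrK.
Qed.

Lemma cutoff_coord R (y : V) (j : 'I_m) : cutoff B n.+1 R y != 0 -> `|y 0 j| <= R%:R.
Proof.
move/cutoff_neq0/ltW => yR; rewrite -(@ler_pXn2r _ 2) ?nnegrE ?ler0n //.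
by rewrite real_normK ?num_real //; apply: le_trans yR.
Qed.

(** Only the weight is displaced by [c]; the lattice stays fixed. A sum over a translate of [Lam]
    inside a slice takes this form. *)
Definition slice_sum (l : V -> rat) (R : nat) (k : rat) (c : V) : rat :=
  fsum (fun y => ((y \in Lam) && (l y == k))%:R * cutoff B n.+1 R (y + c)).

Lemma slice_sum_cover (P : pred V) M R (c y : V) : (forall j, `|c 0 j| <= M%:R) ->
  ((y \in Lam) && P y)%:R * cutoff B n.+1 R (y + c) != 0 -> y \in grid m 1 (R + M).
Proof.
move=> c_le; rewrite mulf_eq0 negb_or => /andP[]; case: andP => // -[yL _] _ y_cutoff.
apply: mem_grid => // [|j]; first by rewrite scale1r; exact: Lam_int.
have := cutoff_coord j y_cutoff; have := c_le j; rewrite mxE natrD !ler_norml.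
by move=> /andP[h1 h2] /andP[h3 h4]; apply/andP; split; lra.
Qed.

Lemma slice_sum_shift (l : V -> rat) R k c h : (forall x y, l (x + y) = l x + l y) ->
  h \in Lam -> l h = 0 -> slice_sum l R k (c + h) = slice_sum l R k c.
Proof.
move=> lD hL lh; rewrite /slice_sum -[RHS](@fsum_reindex _ _ (+%R^~ h) (+%R^~ (- h))).
- by apply: eq_fsum => y; rewrite LamDr // lD lh addr0 addrAC addrA addrAC.
- by move=> y; rewrite addrK.
- by move=> y; rewrite addrNK.
Qed.

(** Along the multiples of [c] the slice sum has period [D]. Its differences of order [n.+1] are at
    most of order [R^(n+1)] for each of [O(R^m)] points, and periodicity passes this bound to the
    first difference. In the exponent [n] counts once, whereas the weight itself has order
    [R^(2(n+1))]. *)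
Lemma slice_sum_smooth (l : V -> rat) (D : nat) (c : V) :
    (forall x y, l (x + y) = l x + l y) -> (0 < D)%N -> c *+ D \in Lam -> l c = 0 ->
  exists2 C, 0 <= C & forall (R : nat) k, (0 < R)%N ->
    `|slice_sum l R k c - slice_sum l R k 0| <= C * R%:R ^+ (m + n.+1).
Proof.
move=> lD D_gt0 cL lc.
have l_mul i : l (c *+ i) = 0.
  elim: i => [|i IHi]; last by rewrite mulrS lD lc IHi addr0.
  by have := lD 0 0; rewrite mulr0n addr0; lra.
have [C C0 C_bd] := cutoff_smooth BDl BZl BC B_ge0 n c.
(* The multiples of [c] that occur are a residue modulo [D] followed by [n.+1] further steps, hence
   stay below [D + n.+1]. *)
pose M := (\max_(j < m) Num.bound (`|c 0%R j| *+ (D + n.+1)))%N.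
have M_bd i j : (i < D + n.+1)%N -> `|(c *+ i) 0 j| <= M%:R.
  move=> le_i; apply: (@le_trans _ _ (`|c 0 j| *+ (D + n.+1))).
    by rewrite -scaler_nat mxE normrM normr_nat mulr_natl; apply: ler_wpMn2l => //; apply: ltnW.
  apply: (@le_trans _ _ (Num.bound (`|c 0 j| *+ (D + n.+1)))%:R).
    by rewrite ltW // archi_boundP // mulrn_wge0.
  by rewrite ler_nat /M (bigD1 j) //= leq_maxl.
exists (D%:R ^+ n * ((2 * M + 3)%:R ^+ m * C)) => [|R k R_gt0].
  by rewrite !mulr_ge0 ?exprn_ge0.
set r : rat := R%:R; have r1 : 1 <= r by rewrite ler1n.
pose s i := slice_sum l R k (c *+ i).
have sP : periodic D s by move=> i; rewrite /s addnC mulrnDr slice_sum_shift.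
pose w y : rat := ((y \in Lam) && (l y == k))%:R.
pose X := grid m 1 (R + M).
have sE i : (i < D + n.+1)%N -> s i = \sum_(y <- X) w y * cutoff B n.+1 R (y + c *+ i).
  move=> lt_i; apply: fsumE; first exact: grid_uniq.
  by move=> y; apply: (slice_sum_cover (P := fun y => l y == k)) => j; apply: M_bd.
have s_bd i : `|iter n.+1 fdiff s i| <= (2 * M + 3)%:R ^+ m * C * r ^+ (m + n.+1).
  rewrite (periodic_mod _ (periodic_fdiff n.+1 sP)).
  have := ltn_pmod i D_gt0; move: (i %% D)%N => {}i lt_i.
  rewrite -[i]addn0 -iter_fdiff_shiftn.
  rewrite (@eq_iter_fdiff _ _
    (fun j => \sum_(y <- X) w y * cutoff B n.+1 R ((y + c *+ i) + c *+ j)) 0) // => [|j le_j].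
    rewrite iter_fdiff_sum; apply: le_trans (ler_norm_sum _ _ _) _.
    apply: (@le_trans _ _ (\sum_(y <- X) C * r ^+ n.+1)).
      apply: ler_sum => y _; rewrite iter_fdiffM normrM.
      apply: le_trans (C_bd R (y + c *+ i) R_gt0).
      by apply: ler_piMl => //; rewrite /w; case: (_ && _); rewrite ?normr1 ?normr0.
    rewrite big_const_seq count_predT iter_addr_0 size_grid -[X in X <= _]mulr_natr.
    have -> : (2 * M + 3)%:R ^+ m * C * r ^+ (m + n.+1) =
      C * r ^+ n.+1 * ((2 * M + 3)%:R * r) ^+ m by rewrite exprD exprMn; ring.
    apply: ler_wpM2l; first by rewrite mulr_ge0 // exprn_ge0 //; lra.
    rewrite natrX; apply: lerXn2r; rewrite ?nnegrE ?ler0n //; first by rewrite -natrM ler0n.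
    rewrite -natrM ler_nat muln1 mulnDr mulnDl -addSn [leqRHS]addnC.
    by rewrite leq_add ?leq_pmulr // [leqRHS]mulSn -add1n leq_add2r.
  by rewrite sE; [apply: eq_bigr => y _; rewrite mulrnDr addrA | rewrite addn0 in le_j; apply: leq_add lt_i le_j].
have := periodic_iter_bound D_gt0 sP s_bd 0; rewrite /fdiff /s mulr1n mulr0n.
by rewrite !mulrA.
Qed.

End Slices.

Lemma Zp_intr_modz D (t : int) (x : 'Z_D) : (1 < D)%N -> t%:~R = x ->
  exists q : int, (x : nat)%:Z = t + q * D%:Z.
Proof.
move=> D_gt1 tx; have D0 : (D%:R : 'Z_D) = 0 by rewrite -Zp_nat_mod // modnn.
pose b := (t %% D%:Z)%Z.
have D_neq0 : D%:Z != 0 by rewrite eqz_nat -lt0n ltnW.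
have b_ge0 : 0 <= b by apply: modz_ge0.
have b_lt : b < D%:Z by apply: ltz_pmod; rewrite ltz_nat ltnW.
have xb : x = b%:~R.
  rewrite -tx (divz_eq t D%:Z) intrD intrM -/b.
  by rewrite -[D%:Z%:~R]/(D%:R) D0 mulr0 add0r.
exists (- (t %/ D%:Z)%Z).
have -> : (x : nat)%:Z = b.
  move: b_ge0 b_lt xb; case: b => // b _; rewrite ltz_nat => b_lt ->.
  by rewrite -[(Posz b)%:~R]/(b%:R) val_Zp_nat // modn_small.
by apply: (@addrI _ ((t %/ D%:Z)%Z * D%:Z)); rewrite /b -divz_eq addrCA mulNr subrr addr0.
Qed.

(** * Comparing two functionals exchanged by an isometric involution *)

Section Reflection.

Variables (m : nat).
Local Notation V := 'rV[rat]_m.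
Variables (B : V -> V -> rat) (Lam : {pred V}).
Hypothesis BDl : forall x y z, B (x + y) z = B x z + B y z.
Hypothesis BZl : forall c x z, B (c *: x) z = c * B x z.
Hypothesis BC : forall x y, B x y = B y x.
Hypothesis B_ge0 : forall x, 0 <= B x x.
Hypothesis B_coord : forall (x : V) (j : 'I_m), x 0 j ^+ 2 <= B x x.
Hypothesis Lam_zmod : zmod_closed Lam.
Hypothesis Lam_int : {subset Lam <= @int_row m}.
Variable n : nat.

Variables (T : V -> V) (D : nat).
Hypothesis TD : forall x y, T (x + y) = T x + T y.
Hypothesis TK : involutive T.
Hypothesis TB : forall y, B (T y) (T y) = B y y.
Hypothesis D_gt1 : (1 < D)%N.
Hypothesis D_Lam : forall y, int_row y -> y *+ D \in Lam.
Hypothesis TD_Lam : forall y, int_row y -> T (y *+ D) \in Lam.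

Local Notation E := 'rV['Z_D]_m.
Definition Zp_lift (e : E) : V := \row_j (e 0 j : nat)%:R.

Lemma Zp_liftP e : int_row (Zp_lift e).
Proof. by apply/forallP => j; rewrite mxE natr_int. Qed.

(** Translation by an integral vector permutes the representatives modulo [D], up to multiples of
    [D]; this reindexes the coset count. *)
Lemma Zp_lift_add z : int_row z ->
  exists e0 : E, forall e, exists2 q, int_row q & Zp_lift (e + e0) = Zp_lift e + z + q *+ D.
Proof.
move=> /forallP z_int; exists (\row_j (Num.floor (z 0 j))%:~R) => e.
have qP j : exists q : int, (Zp_lift (e + \row_j (Num.floor (z 0 j))%:~R)) 0 j
    = (Zp_lift e + z) 0 j + q%:~R *+ D.
  rewrite !mxE; set x : 'Z_D := _ + _.
  have [|q xq] := @Zp_intr_modz D ((e 0 j : nat)%:Z + Num.floor (z 0 j)) x D_gt1.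
    by rewrite intrD /x -[(Posz _)%:~R]/(_%:R) natr_Zp.
  exists q; have -> : ((x : nat)%:R : rat) = (e 0 j : nat)%:R + z 0 j + q%:~R * D%:R.
    by rewrite pmulrn xq !intrD intrM floorK ?z_int // -!pmulrn.
  by rewrite mulr_natr.
have [q qE] := fin_all_exists qP.
exists (\row_j (q j)%:~R); first by apply/forallP => j; rewrite mxE rpred_int.
apply/rowP => j; rewrite qE !mxE -[in RHS]scaler_nat mxE mulr_natl.
by rewrite !mxE.
Qed.

(* [Zp_lift e] runs over representatives of [Z^m] modulo [D], so that the count is
   a positive constant on [Lam + T Lam] and zero elsewhere; hence it is invariant
   under [T], which [Lam] is not. *)
Definition coset_count (y : V) : rat :=
  \sum_(e : E) ((Zp_lift e \in Lam) && (y - T (Zp_lift e) \in Lam))%:R.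

Local Notation LamDr := (LamDr Lam_zmod).

Lemma LamN x : (- x \in Lam) = (x \in Lam).
Proof.
have [L0 LB] := Lam_zmod.
by apply/idP/idP => xL; [rewrite -[x]opprK|]; rewrite -sub0r; apply: LB.
Qed.

Lemma T0 : T 0 = 0.
Proof. by have /eqP := TD 0 0; rewrite addr0 eq_sym -subr_eq0 addrK => /eqP. Qed.

Lemma TMn x i : T (x *+ i) = T x *+ i.
Proof. by elim: i => [|i IHi]; rewrite ?mulr0n ?T0 // !mulrS TD IHi. Qed.

(** Shifting the index by the residue of [z] changes [Zp_lift e] by [z] and some [q *+ D]. As
    [q *+ D] and [T (q *+ D)] lie in [Lam], both membership tests keep their value. *)
Lemma coset_count_const x z : x \in Lam -> z \in Lam ->
  coset_count (x + T z) = coset_count 0.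
Proof.
move=> xL zL; have [e0 e0P] := Zp_lift_add (Lam_int zL).
rewrite /coset_count (reindex_inj (addIr e0)); apply: eq_bigr => e _ /=.
have [q q_int ->] := e0P e; congr (_%:R : rat); congr (nat_of_bool _).
rewrite LamDr ?D_Lam // LamDr //; congr (_ && _).
have -> : x + T z - T (Zp_lift e + z + q *+ D) = (0 - T (Zp_lift e)) + (x - T (q *+ D)).
  by rewrite !TD; apply/rowP => j; rewrite !mxE; ring.
by rewrite LamDr // (Lam_zmod.2 _ _ xL (TD_Lam q_int)).
Qed.

Lemma coset_count_neq0 y : coset_count y != 0 ->
  exists2 z, z \in Lam & y - T z \in Lam.
Proof.
move=> cnt; have [e /andP[]] : exists e : E, (Zp_lift e \in Lam) && (y - T (Zp_lift e) \in Lam).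
  apply/existsP; apply: contraNT cnt; rewrite negb_exists => /forallP no_e.
  by rewrite /coset_count big1 // => e _; rewrite (negPf (no_e e)).
by exists (Zp_lift e).
Qed.

Lemma coset_countT y : coset_count (T y) = coset_count y.
Proof.
have le y' : coset_count y' != 0 -> coset_count (T y') = coset_count y'.
  case/coset_count_neq0 => z zL yzL; rewrite -(subrK (T z) y') coset_count_const //.
  by rewrite TD TK addrC coset_count_const.
have [y0|/le//] := eqVneq (coset_count y) 0.
have [Ty0|/le] := eqVneq (coset_count (T y)) 0; first by rewrite Ty0 y0.
by rewrite TK => <-.
Qed.

Section OneSlice.

Variables (l : V -> rat) (h : V).
Hypothesis lD : forall x y, l (x + y) = l x + l y.
Hypothesis hL : h \in Lam.
Hypothesis lh : l h = 1.
Hypothesis lT_int : forall y, y \in Lam -> l (T y) \is a Num.int.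

(** The slice sum over the [T]-invariant group [Lam + T Lam], counted with constant multiplicity. *)
Definition fine_slice_sum (R : nat) (k : rat) : rat :=
  fsum (fun y => coset_count y * (l y == k)%:R * cutoff B n.+1 R y).

Definition num_cosets : rat := \sum_(e : E) (Zp_lift e \in Lam)%:R.

Let l0 : l 0 = 0.
Proof. by have := lD 0 0; rewrite addr0; lra. Qed.

Let lN x : l (- x) = - l x.
Proof. by apply/eqP; rewrite -addr_eq0 -lD addNr l0. Qed.

Let lMn x i : l (x *+ i) = l x *+ i.
Proof. by elim: i => [|i IHi]; rewrite ?mulr0n ?l0 // !mulrS lD IHi. Qed.

Let lMz x i : l (x *~ i) = l x *~ i.
Proof. by case: i => i; rewrite -?pmulrn ?NegzE ?mulrNz -?pmulrn ?lN lMn. Qed.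

Let LamMz x (i : int) : x \in Lam -> x *~ i \in Lam.
Proof.
move=> xL; have mL k : x *+ k \in Lam.
  elim: k => [|k IHk]; first by rewrite mulr0n; have [] := Lam_zmod.
  by rewrite mulrS LamDr.
by case: i => i; rewrite -?pmulrn ?NegzE ?mulrNz -?pmulrn ?LamN mL.
Qed.

(** [Lam + T Lam] is cut into the cosets of [T (Zp_lift e)]. As [l h = 1] and [l] is integral on
    [T Lam], a multiple of [h] can be subtracted to make the representative vanish under [l] without
    changing its coset, so the translation preserves slices. *)
Lemma fine_slice_sumE R k :
  exists2 c : E -> V,
     (forall e, c e = T (Zp_lift e) - h *~ Num.floor (l (T (Zp_lift e)))) &
  fine_slice_sum R k = \sum_(e : E | Zp_lift e \in Lam) slice_sum B Lam n l R k (c e).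
Proof.
exists (fun e => T (Zp_lift e) - h *~ Num.floor (l (T (Zp_lift e)))) => //.
pose g e y : rat := ((y - T (Zp_lift e) \in Lam) && (l y == k))%:R * cutoff B n.+1 R y.
pose X := grid m D R.
have gX e y : Zp_lift e \in Lam -> g e y != 0 -> y \in X.
  move=> eL; rewrite /g mulf_eq0 negb_or => /andP[]; case: andP => // -[yL _] _ y_cutoff.
  apply: mem_grid => [||j]; first exact: ltnW.
    rewrite scaler_nat -(subrK (T (Zp_lift e)) y) mulrnDl -TMn.
    apply: Lam_int; rewrite LamDr; first exact: D_Lam (Lam_int yL).
    exact: TD_Lam (Zp_liftP e).
  exact: (cutoff_coord B_coord j y_cutoff).
have slE e : Zp_lift e \in Lam ->
   slice_sum B Lam n l R k (T (Zp_lift e) - h *~ Num.floor (l (T (Zp_lift e)))) = \sum_(y <- X) g e y.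
  move=> eL; rewrite -(@fsumE _ X (g e)); last by move=> y; apply: gX.
    set q := Num.floor _; pose t := T (Zp_lift e) - h *~ q.
    rewrite /slice_sum -[RHS](@fsum_reindex _ _ (+%R^~ t) (+%R^~ (- t))).
    - apply: eq_fsum => y; rewrite /g -/t; congr (_%:R * _); congr (nat_of_bool _).
      have lt : l t = 0.
        by rewrite lD lN lMz lh /q floorK ?subrr // lT_int.
      rewrite lD lt addr0; congr (_ && _).
      have -> : y + t - T (Zp_lift e) = y - h *~ q by rewrite /t; apply/rowP => j; rewrite !mxE; ring.
      by rewrite LamDr // LamN LamMz.
    - by move=> y; rewrite addrK.
    - by move=> y; rewrite subrK.
  exact/grid_uniq/ltnW.
rewrite (eq_bigr _ slE) exchange_big /= -[RHS](@fsumE _ X).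
- apply: eq_fsum => y; rewrite /coset_count !mulr_suml [RHS]big_mkcond /=.
  by apply: eq_bigr => e _; rewrite /g; case: (_ \in Lam); case: (_ \in Lam); case: eqP; rewrite ?mul1r ?mul0r ?mulr0 ?mul0r.
- exact/grid_uniq/ltnW.
- move=> y; apply: contraNT => yX; rewrite big1 // => e eL.
  by apply/eqP; apply: contraNT yX; apply: gX.
Qed.

Lemma fine_slice_sum_approx :
  exists2 C, 0 <= C & forall (R : nat) k, (0 < R)%N ->
    `|fine_slice_sum R k - num_cosets * slice_sum B Lam n l R k 0| <= C * R%:R ^+ (m + n.+1).
Proof.
have eC (e : E) : exists C, 0 <= C /\ (Zp_lift e \in Lam -> forall (R : nat) k, (0 < R)%N ->
   `|slice_sum B Lam n l R k (T (Zp_lift e) - h *~ Num.floor (l (T (Zp_lift e)))) -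
     slice_sum B Lam n l R k 0| <= C * R%:R ^+ (m + n.+1)).
  have [eL|_] := boolP (Zp_lift e \in Lam); last by exists 0.
  set c := T _ - _.
  have D_gt0 : (0 < D)%N by apply: ltnW.
  have cL : c *+ D \in Lam.
    rewrite /c mulrnBl -TMn (Lam_zmod.2 _ _ (TD_Lam (Zp_liftP e))) //.
    by rewrite pmulrn -mulrzA LamMz.
  have lc : l c = 0 by rewrite /c lD lN lMz lh floorK ?subrr // lT_int.
  have [C C0 C_bd] := slice_sum_smooth BDl BZl BC B_ge0 B_coord Lam_zmod Lam_int n lD D_gt0 cL lc.
  by exists C.
have [C CP] := fin_all_exists eC; exists (\sum_e C e) => [|R k R_gt0].
  by rewrite sumr_ge0 // => e _; have [] := CP e.
have [c cE ->] := fine_slice_sumE R k.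
have -> : num_cosets * slice_sum B Lam n l R k 0 =
    \sum_(e : E | Zp_lift e \in Lam) slice_sum B Lam n l R k 0.
  rewrite /num_cosets mulr_suml [RHS]big_mkcond /=; apply: eq_bigr => e _.
  by case: ifP; rewrite ?mul1r ?mul0r.
rewrite -sumrB mulr_suml; apply: le_trans (ler_norm_sum _ _ _) _.
rewrite big_mkcond /=; apply: ler_sum => e _; have [C0 C_bd] := CP e.
by case: ifP => eL; [rewrite cE C_bd | rewrite mulr_ge0 // exprn_ge0].
Qed.

Lemma num_cosets_ge1 : 1 <= num_cosets.
Proof.
rewrite /num_cosets (bigD1 0) //= (_ : Zp_lift 0 = 0); last first.
  by apply/rowP => j; rewrite !mxE.
by have [-> _] := Lam_zmod; rewrite lerDl sumr_ge0 // => e _.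
Qed.

End OneSlice.

Lemma fine_slice_sumT (l l' : V -> rat) R k : (forall y, l' (T y) = l y) ->
  fine_slice_sum l' R k = fine_slice_sum l R k.
Proof.
move=> lT; rewrite /fine_slice_sum -(fsum_reindex _ TK TK); apply: eq_fsum => y.
by rewrite coset_countT lT /cutoff TB.
Qed.

(** The fine sums of [l] and [l'] are equal, since [T] exchanges the functionals and preserves count
    and weight. Each is [num_cosets] times an ordinary slice sum up to the error, and
    [num_cosets >= 1]. *)
Lemma slice_sum_reflect (l l' : V -> rat) (h h' : V) :
    (forall x y, l (x + y) = l x + l y) -> (forall x y, l' (x + y) = l' x + l' y) ->
    (forall y, l' (T y) = l y) ->
    (forall y, y \in Lam -> l y \is a Num.int) -> (forall y, y \in Lam -> l' y \is a Num.int) ->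
    h \in Lam -> l h = 1 -> h' \in Lam -> l' h' = 1 ->
  exists2 C, 0 <= C & forall (R : nat) k, (0 < R)%N ->
    `|slice_sum B Lam n l R k 0 - slice_sum B Lam n l' R k 0| <= C * R%:R ^+ (m + n.+1).
Proof.
move=> lD l'D lT l_int l'_int hL lh h'L l'h'.
have lT' y : l (T y) = l' y by rewrite -lT TK.
have [|C C0 C_bd] := fine_slice_sum_approx lD hL lh.
  by move=> y yL; rewrite lT' l'_int.
have [|C' C'0 C'_bd] := fine_slice_sum_approx l'D h'L l'h'.
  by move=> y yL; rewrite lT l_int.
exists (C + C') => [|R k R_gt0]; first exact: addr_ge0.
have := C_bd R k R_gt0; have := C'_bd R k R_gt0; rewrite (fine_slice_sumT _ _ lT).
have := num_cosets_ge1; move: num_cosets => N N1.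
set F := fine_slice_sum _ _ _; set M := slice_sum _ _ _ _ _ _ _; set M' := slice_sum _ _ _ _ _ _ _.
rewrite mulrDl; set X := C * _; set Y := C' * _ => h1 h2.
have : `|N * (M' - M)| <= X + Y.
  have -> : N * (M' - M) = (F - N * M) - (F - N * M') by ring.
  apply: le_trans (ler_normB _ _) _; lra.
rewrite normrM ger0_norm; last lra.
by rewrite distrC; apply: le_trans; rewrite ler_peMl.
Qed.

End Reflection.

(** * Moving defects inward *)

Lemma common_denominator (F : finType) (f : F -> rat) :
  exists2 N : nat, (0 < N)%N & forall t, f t *+ N \is a Num.int.
Proof.
exists (\prod_t `|denq (f t)|)%N => [|t].
  by rewrite prodn_gt0 // => t; rewrite absz_gt0 denq_neq0.
rewrite (bigD1 t) //= mulrnA rpredMn // -mulr_natr.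
have -> : (`|denq (f t)|%N%:R : rat) = (denq (f t))%:~R by rewrite pmulrn absz_denq.
by rewrite -numqE rpred_int.
Qed.

Lemma functional_denominator m (F : finType) (f : F -> 'rV[rat]_m -> rat) :
    (forall t x y, f t (x + y) = f t x + f t y) ->
    (forall t c x, f t (c *: x) = c * f t x) ->
  exists2 N : nat, (0 < N)%N & forall t y, int_row y -> f t (y *+ N) \is a Num.int.
Proof.
move=> fD fZ; have [N N_gt0 NP] := common_denominator (fun u : F * 'I_m => f u.1 (delta_mx 0 u.2)).
exists N => // t y /forallP y_int.
have f0 : f t 0 = 0 by rewrite -(scale0r 0) fZ mul0r.
rewrite -scaler_nat fZ {1}(row_sum_delta y) (big_morph (f t) (fD t) f0) mulr_sumr.
by apply: rpred_sum => j _; rewrite fZ mulrCA rpredM //= mulr_natl; apply: (NP (t, j)).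
Qed.

(** Bernoulli's inequality for [x^-1]. *)
Lemma expr_small (x e : rat) : 0 <= x -> x < 1 -> 0 < e -> exists A : nat, x ^+ A <= e.
Proof.
move=> x0 x1 e0; have [->|x_neq0] := eqVneq x 0; first by exists 1%N; rewrite expr1 ltW.
have x_gt0 : 0 < x by rewrite lt_def x_neq0.
have bern A : 1 + A%:R * (x^-1 - 1) <= x^-1 ^+ A.
  have y1 : 1 <= x^-1 by rewrite invf_ge1 // ltW.
  elim: A => [|A IHA]; first by rewrite mul0r addr0 expr0.
  have : 1 <= x^-1 ^+ A by rewrite exprn_ege1.
  by rewrite exprS -natr1; nra.
have y1 : 0 < x^-1 - 1 by rewrite subr_gt0 invf_gt1.
have [A lt_e] : exists A : nat, e^-1 < A%:R * (x^-1 - 1).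
  exists (Num.bound (e^-1 / (x^-1 - 1))); rewrite -ltr_pdivrMr //.
  by apply: archi_boundP; rewrite divr_ge0 ?invr_ge0 // ltW.
exists A; rewrite -lef_pV2 ?posrE ?exprn_gt0 // -exprVn.
apply: le_trans (bern A); apply: ltW; apply: lt_le_trans lt_e _.
by rewrite lerDr.
Qed.

Section Weights.

Variables (m : nat) (I : finType).
Local Notation V := 'rV[rat]_m.
Variables (B : V -> V -> rat) (w : I -> V).
Hypothesis BDl : forall x y z, B (x + y) z = B x z + B y z.
Hypothesis BZl : forall c x z, B (c *: x) z = c * B x z.
Hypothesis BC : forall x y, B x y = B y x.
Hypothesis B_ge0 : forall x, 0 <= B x x.
Hypothesis B_w : forall i, B (w i) (w i) = 1.
Hypothesis w_coord : forall j : 'I_m, exists i, forall y : V, y 0 j = B (w i) y.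

(** The vector [w i] represents the [i]-th coordinate functional through the form; these are the
    integral points of the hyperplane. *)
Definition lattice : {pred V} := [pred y : V | [forall i, B (w i) y \is a Num.int]].

Hypothesis lattice_onto : forall i, exists2 h, h \in lattice & B (w i) h = 1.

Lemma latticeP y : reflect (forall i, B (w i) y \is a Num.int) (y \in lattice).
Proof. exact: forallP. Qed.

Let BDr x y z : B x (y + z) = B x y + B x z.
Proof. by rewrite BC BDl ![B _ x]BC. Qed.

Let BZr c x y : B x (c *: y) = c * B x y.
Proof. by rewrite BC BZl BC. Qed.

Let BNr x y : B x (- y) = - B x y.
Proof. by rewrite -scaleN1r BZr mulN1r. Qed.

Let BMnr x y i : B x (y *+ i) = B x y *+ i.
Proof. by rewrite -scaler_nat BZr mulr_natl. Qed.

Let BMzr x y i : B x (y *~ i) = B x y *~ i.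
Proof. by rewrite -scaler_int BZr mulrzl. Qed.

Lemma lattice_zmod : zmod_closed lattice.
Proof.
split=> [|x y /latticeP xL /latticeP yL]; apply/latticeP => i.
  by rewrite -(scale0r 0) BZr mul0r.
by rewrite BDr BNr rpredB.
Qed.

Lemma lattice_int : {subset lattice <= @int_row m}.
Proof.
move=> y /latticeP yL; apply/forallP => j; have [i ->] := w_coord j.
exact: yL.
Qed.

Lemma l_bound i y : B (w i) y ^+ 2 <= B y y.
Proof. by have := form_Cauchy_Schwarz BDl BZl BC B_ge0 (w i) y; rewrite B_w mul1r. Qed.

Lemma coord_bound (x : V) (j : 'I_m) : x 0 j ^+ 2 <= B x x.
Proof. by have [i ->] := w_coord j; apply: l_bound. Qed.

Variable n : nat.

(** Since [w i] and [w j] have the same norm, the reflection along [w i - w j] exchanges them. *)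
Lemma slices_close_pair i j :
  exists2 C, 0 <= C & forall (R : nat) k, (0 < R)%N ->
    `|slice_sum B lattice n (B (w i)) R k 0 - slice_sum B lattice n (B (w j)) R k 0|
      <= C * R%:R ^+ (m + n.+1).
Proof.
pose a := 1 - B (w i) (w j); pose v := w i - w j.
have vE y : B v y = B (w i) y - B (w j) y by rewrite BC BDr BNr BC [B y _]BC.
have vv : B v v = 2 * a.
  by rewrite vE /v !BDr !BNr !B_w [B (w j) _]BC /a; ring.
(* If [a = 0] then [v] has norm zero, and by Cauchy-Schwarz the two functionals coincide. *)
have [a0|a_neq0] := eqVneq a 0.
  exists 0 => // R k _; rewrite mul0r normr_le0 subr_eq0; apply/eqP.
  apply: eq_fsum => y; have : B v y ^+ 2 <= 0.
    by have := form_Cauchy_Schwarz BDl BZl BC B_ge0 v y; rewrite vv a0 mulr0 mul0r.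
  by rewrite le_eqVlt ltNge sqr_ge0 orbF sqrf_eq0 vE subr_eq0 => /eqP->.
(* The usual reflection formula, as [B v v = 2 * a]. *)
pose T y := y - (B v y / a) *: v.
have vT y : B v (T y) = - B v y by rewrite /T BDr BNr BZr vv; field.
have lT y : B (w i) (T y) = B (w j) y.
  by rewrite /T BDr BNr BZr /v BDr BNr B_w -/a vE; field.
have TD x y : T (x + y) = T x + T y.
  by rewrite /T BDr mulrDl scalerDl opprD addrACA.
have TK : involutive T.
  by move=> y; rewrite {1}/T vT mulNr scaleNr opprK /T subrK.
have TB y : B (T y) (T y) = B y y.
  rewrite {2}/T BDr BNr BZr [B _ v]BC vT {1}/T BDl -scaleNr BZl.
  by field.
have lTj y : B (w j) (T y) = B (w i) y by rewrite -[in RHS](TK y) lT.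
have TZ c y : T (c *: y) = c *: T y.
  by rewrite /T BZr; apply/rowP => k; rewrite !mxE; ring.
pose f (u : I + I) y := match u with inl t => B (w t) y | inr t => B (w t) (T y) end.
have fD u x y : f u (x + y) = f u x + f u y by case: u => t /=; rewrite ?TD BDr.
have fZ u c y : f u (c *: y) = c * f u y by case: u => t /=; rewrite ?TZ BZr.
have [N N_gt0 NP] := functional_denominator fD fZ.
(* The factor 2 ensures [1 < D], so that ['Z_D] is the ring of integers modulo [D]. *)
pose D := (N * 2)%N; have D_gt1 : (1 < D)%N by apply: leq_pmull.
have D_lat y : int_row y -> y *+ D \in lattice.
  by move=> yZ; apply/latticeP => t; rewrite /D mulrnA BMnr rpredMn // (NP (inl t)).
have TD_lat y : int_row y -> T (y *+ D) \in lattice.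
  move=> yZ; apply/latticeP => t.
  by rewrite /D mulrnA mulr2n TD BDr rpredD // (NP (inr t)).
have [h hL wh] := lattice_onto i; have [h' h'L wh'] := lattice_onto j.
apply: (slice_sum_reflect BDl BZl BC B_ge0 coord_bound lattice_zmod lattice_int n
   TD TK TB D_gt1 D_lat TD_lat _ _ lTj _ _ hL wh h'L wh') => [x y|x y|y|y]; try exact: BDr.
  by move/latticeP.
by move/latticeP.
Qed.

Lemma slices_close :
  exists2 C, 0 <= C & forall i j (R : nat) k, (0 < R)%N ->
    `|slice_sum B lattice n (B (w i)) R k 0 - slice_sum B lattice n (B (w j)) R k 0|
      <= C * R%:R ^+ (m + n.+1).
Proof.
have [C CP] := fin_all_exists (fun u : I * I => let: ex_intro2 C C0 CP := slices_close_pair u.1 u.2 in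
   ex_intro (fun C => 0 <= C /\ forall (R : nat) k, (0 < R)%N -> _ <= C * R%:R ^+ (m + n.+1)) C (conj C0 CP)).
exists (\sum_u C u) => [|i j R k R_gt0]; first by apply: sumr_ge0 => u _; have [] := CP u.
have [C0 /(_ R k R_gt0)/= le_C] := CP (i, j); apply: le_trans le_C _.
rewrite ler_wpM2r ?exprn_ge0 // (bigD1 (i, j)) //= lerDl sumr_ge0 // => u _.
by have [] := CP u.
Qed.

(** * Reducing large values at polynomial cost *)

Section Push.

Variable lam : rat.
Hypothesis lam_lt1 : lam < 1.
Hypothesis strict : forall i, exists2 p, B (w i) p = 1 &
  forall j, j != i -> `|B (w j) p| <= lam.

(** The rational point [k *: p] has the desired values; it is rounded to the lattice with bounded
    error and without changing the value of the functional [i]. *)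
Lemma push_point : exists2 C, 0 <= C & forall i k, k \is a Num.int ->
  exists2 y, y \in lattice & B (w i) y = k /\
    forall j, j != i -> `|B (w j) y| <= lam * `|k| + C.
Proof.
have one i : exists C, 0 <= C /\ forall k, k \is a Num.int ->
  exists2 y, y \in lattice & B (w i) y = k /\
    forall j, j != i -> `|B (w j) y| <= lam * `|k| + C.
  have [h hL wh] := lattice_onto i; have [p wp p_le] := strict i.
  have [D D_gt0 DP] := common_denominator (fun j => B (w j) (p - h)).
  exists (D%:R * \sum_j `|B (w j) (p - h)|); split.
    by rewrite mulr_ge0 // sumr_ge0.
  move=> k /intrP[q ->].
  have dL : (p - h) *+ D \in lattice by apply/latticeP => j; rewrite BMnr DP.
  have D_neq0 : D%:Z != 0 by rewrite eqz_nat -lt0n.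
  (* This is [q *: p] minus [q mod D] times [p - h], and the functional [i] vanishes on [p - h]. *)
  exists (h *~ q + (p - h) *+ D *~ (q %/ D%:Z)%Z).
    have [/latticeP hL' /latticeP dL'] := (hL, dL).
    by apply/latticeP => j; rewrite BDr !BMzr rpredD // rpredMz.
  have yE j : B (w j) (h *~ q + (p - h) *+ D *~ (q %/ D%:Z)%Z) =
     q%:~R * B (w j) p - (q %% D%:Z)%Z%:~R * B (w j) (p - h).
    rewrite [LHS]BDr !BMzr BMnr -(mulr_natr (B _ _)) -(mulrzr (B (w j) h)) -(mulrzr (_ * _)).
    rewrite !BDr BNr.
    have -> : (q%:~R : rat) = (q %/ D%:Z)%Z%:~R * D%:R + (q %% D%:Z)%Z%:~R.
      by rewrite {1}(divz_eq q D%:Z) intrD intrM.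
    have alg (Q E r P H : rat) : H * (Q * E + r) + (P - H) * E * Q = (Q * E + r) * P - r * (P - H).
      by ring.
    exact: alg.
  split=> [|j ji]; first by rewrite yE BDr BNr wp wh subrr mulr0 subr0 mulr1.
  rewrite yE; apply: le_trans (ler_normB _ _) _; rewrite !normrM.
  apply: lerD; first by rewrite mulrC ler_wpM2r // p_le.
  have r_ge0 : 0 <= ((q %% D%:Z)%Z%:~R : rat) by rewrite ler0z modz_ge0.
  apply: ler_pM => //; last by rewrite (bigD1 j) //= lerDl sumr_ge0.
  rewrite ger0_norm // -[D%:R]/(D%:Z%:~R) ler_int ltW // ltz_pmod //.
have [C CP] := fin_all_exists one.
exists (\sum_i C i) => [|i k kZ]; first by apply: sumr_ge0 => i _; have [] := CP i.
have [C0 /(_ k kZ)[y yL [yk y_le]]] := CP i; exists y => //; split=> // j ji.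
apply: le_trans (y_le j ji) _; rewrite lerD2l (bigD1 i) //= lerDl sumr_ge0 // => i' _.
by have [] := CP i'.
Qed.

(* A weighted set of points [om] has equal coordinate distributions if and only if
   [pairing om f = 0] for all [f] with [zero_sum f]. *)
Definition zero_sum (f : I -> rat -> rat) := forall k, \sum_i f i k = 0.

Definition pairing (om : seq (rat * V)) (f : I -> rat -> rat) : rat :=
  \sum_(p <- om) p.1 * \sum_i f i (B (w i) p.2).

(** Signed masses at pairs of a coordinate and a value. Testing against zero-sum [f] disregards
    equal masses placed at one value in all coordinates. *)
Definition defect (de : seq (rat * (I * rat))) (f : I -> rat -> rat) : rat :=
  \sum_(p <- de) p.1 * f p.2.1 p.2.2.

Definition bounded_defect (L : rat) (de : seq (rat * (I * rat))) :=
  {in de, forall p, p.2.2 \is a Num.int /\ `|p.2.2| <= L}.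

(* The functional [F] can be corrected by lattice points of nonnegative weight to
   a defect supported on values of size at most [L] and of total mass at most [c]. *)
Definition pushable (L c : rat) (F : (I -> rat -> rat) -> rat) :=
  exists om de, [/\ {in om, forall p, 0 <= p.1 /\ p.2 \in lattice},
    bounded_defect L de, \sum_(p <- de) `|p.1| <= c &
    forall f, zero_sum f -> F f + pairing om f = defect de f].

Lemma pushable_le L c c' F : c <= c' -> pushable L c F -> pushable L c' F.
Proof. by move=> le_c [om [de [? ? ? ?]]]; exists om, de; split=> //; apply: le_trans le_c. Qed.

Lemma pushable_ext L c F G :
  (forall f, zero_sum f -> F f = G f) -> pushable L c F -> pushable L c G.
Proof.
by move=> FG [om [de [? ? ? E]]]; exists om, de; split=> // f f0; rewrite -FG ?E.
Qed.

Lemma pushable0 L : pushable L 0 (fun=> 0).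
Proof.
by exists [::], [::]; split=> // [|f _]; rewrite /pairing /defect !big_nil ?addr0.
Qed.

Lemma pushableD L c d F G :
  pushable L c F -> pushable L d G -> pushable L (c + d) (fun f => F f + G f).
Proof.
move=> [om [de [om0 deL dec E]]] [om' [de' [om'0 de'L de'c E']]].
exists (om ++ om'), (de ++ de'); split=> [p|p||f f0].
- by rewrite mem_cat => /orP[/om0|/om'0].
- by rewrite mem_cat => /orP[/deL|/de'L].
- by rewrite big_cat lerD.
- by rewrite /pairing /defect !big_cat /= -/(defect de f) -/(defect de' f) -E // -E' // addrACA.
Qed.

Lemma pushable_sum L (T : Type) (s : seq T) (P : pred T) (c : T -> rat) F :
    (forall t, P t -> pushable L (c t) (F t)) ->
  pushable L (\sum_(t <- s | P t) c t) (fun f => \sum_(t <- s | P t) F t f).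
Proof.
move=> push; elim: s => [|t s IHs].
  rewrite big_nil; apply: (pushable_ext (F := fun=> 0)) (pushable0 L) => f _.
  by rewrite big_nil.
rewrite big_cons; case Pt: (P t).
  apply: (pushable_ext (F := fun f => F t f + \sum_(t <- s | P t) F t f)).
    by move=> f _; rewrite big_cons Pt.
  by apply: pushableD => //; apply: push.
by apply: pushable_ext IHs => f _; rewrite big_cons Pt.
Qed.

Lemma pushableZ L c a F : 0 <= a -> pushable L c F -> pushable L (a * c) (fun f => a * F f).
Proof.
move=> a0 [om [de [om0 deL dec E]]].
exists [seq (a * p.1, p.2) | p <- om], [seq (a * p.1, p.2) | p <- de]; split=> [_ /mapP[p p_om ->]|_ /mapP[p p_de ->]||f f0] /=.
- by have [p0 pL] := om0 p p_om; split; rewrite ?mulr_ge0.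
- exact: deL.
- rewrite big_map /=; under eq_bigr do rewrite normrM.
  by rewrite -mulr_sumr ger0_norm // ler_wpM2l.
rewrite /pairing /defect !big_map /=.
under eq_bigr do rewrite -mulrA; rewrite -mulr_sumr -mulrDr E //.
by rewrite /defect mulr_sumr; apply: eq_bigr => p _; rewrite mulrA.
Qed.

Lemma pushable_point L k y c F : 0 <= k -> y \in lattice ->
    pushable L c (fun f => F f + k * \sum_i f i (B (w i) y)) ->
  pushable L c F.
Proof.
move=> k0 yL [om [de [om0 deL dec E]]]; exists ((k, y) :: om), de; split=> //.
  by move=> p; rewrite inE => /predU1P[->|/om0].
by move=> f f0; rewrite -E // /pairing big_cons /= addrA.
Qed.

Lemma int_norm_lt (x : rat) (N : nat) : x \is a Num.int -> `|x| < N.+1%:R -> `|x| <= N%:R.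
Proof.
move=> /intrP[q ->]; by rewrite -intr_norm !pmulrn ltr_int ler_int intS addrC ltzD1.
Qed.

(** A mass at a value [k] beyond [L] is traded for at most [r^2] masses at values at most
    [mu * |k|], where [r] is the number of coordinates. The total mass therefore grows only like a
    power of [|k|]. *)
Lemma pushable_unit : 0 <= lam -> (0 < #|I|)%N ->
  exists L A : nat, forall i k (s : bool), k \is a Num.int ->
    pushable L%:R (Num.max 1 `|k| ^+ A) (fun f => (-1) ^+ s * f i k).
Proof.
move=> lam0 I_gt0; have [C C0 CP] := push_point; have lam1 := lam_lt1.
pose mu := (1 + lam) / 2; have mu_lt1 : mu < 1 by rewrite /mu; lra.
have mu_ge : 1 / 2 <= mu by rewrite /mu; lra.
pose r : rat := #|I|%:R; have r_ge1 : 1 <= r by rewrite ler1n.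
(* The exponent for which the contraction by [mu] pays for the branching into [r * r] masses. *)
have [A muA] : exists A : nat, mu ^+ A <= (r * r)^-1.
  apply: expr_small => //; first lra.
  by rewrite invr_gt0; nra.
have {}muA : r * r * mu ^+ A <= 1.
  by rewrite mulrC -ler_pdivlMr ?div1r //; nra.
(* Beyond [L] the rounding error [C] fits into the gap between [lam] and [mu]; [2 <= L] gives
   [1 <= mu * |k|], so that the maximum with 1 is harmless. *)
have [L L_ge2 L_C] : exists2 L : nat, 2%:R <= L%:R :> rat & C <= (1 - lam) / 2 * L%:R.
  exists (Num.bound (C / ((1 - lam) / 2)) + 2)%N; first by rewrite ler_nat leq_addl.
  have lam' : 0 < (1 - lam) / 2 by lra.
  rewrite mulrC -ler_pdivrMr // natrD.
  have : C / ((1 - lam) / 2) < (Num.bound (C / ((1 - lam) / 2)))%:R.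
    by apply: archi_boundP; rewrite divr_ge0 // ltW.
  by move/ltW/le_trans; apply; rewrite lerDl.
exists L, A => i k s kZ.
have [N kN] : exists N : nat, `|k| <= N%:R.
  by exists (Num.bound `|k|); rewrite ltW // archi_boundP.
elim: N i k s kZ kN => [|N IHN] i k s kZ kN; have [k_le|k_gt] := leP `|k| L%:R.
- exists [::], [:: ((-1) ^+ s, (i, k))]; split=> //.
  + by move=> p; rewrite inE => /eqP->.
  + rewrite big_seq1 normrX normrN1 expr1n exprn_ege1 // le_max lexx //.
  + by move=> f _; rewrite /pairing /defect big_nil big_seq1 addr0.
- have : L%:R < 0 :> rat by apply: lt_le_trans k_gt kN.
  by rewrite ltNge ler0n.
- exists [::], [:: ((-1) ^+ s, (i, k))]; split=> //.
  + by move=> p; rewrite inE => /eqP->.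
  + rewrite big_seq1 normrX normrN1 expr1n exprn_ege1 // le_max lexx //.
  + by move=> f _; rewrite /pairing /defect big_nil big_seq1 addr0.
have k_ge2 : 2 <= `|k| by apply: le_trans (ltW k_gt).
have mk_ge1 : 1 <= mu * `|k| by nra.
(* A negative mass is cancelled by a lattice point with value [k] in the coordinate [i']. Its other
   values are smaller, so the induction hypothesis applies to them. *)
have neg i' : pushable L%:R (r * (mu * `|k|) ^+ A) (fun f => - f i' k).
  have [y yL [yk y_le]] := CP i' k kZ.
  apply: (@pushable_point _ 1 y) => //.
  apply: (pushable_ext (F := fun f => \sum_(j | j != i') (-1) ^+ false * f j (B (w j) y))).
    move=> f f0; rewrite mul1r [in RHS](bigD1 i') //= yk addKr.
    by apply: eq_bigr => j _; rewrite expr0 mul1r.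
  apply: (@pushable_le _ (\sum_(j | j != i') (mu * `|k|) ^+ A)).
    rewrite sumr_const -mulr_natl ler_wpM2r ?exprn_ge0 //; first by nra.
    by rewrite ler_nat max_card.
  apply: pushable_sum => j ji.
  have yj_le : `|B (w j) y| <= mu * `|k|.
    by apply: le_trans (y_le j ji) _; rewrite /mu; nra.
  have yjZ : B (w j) y \is a Num.int by move/latticeP: yL.
  apply: pushable_le (IHN j (B (w j) y) false yjZ _).
    by apply: lerXn2r; rewrite ?nnegrE ?le_max ?ler01 //; [lra | rewrite ge_max mk_ge1].
  apply: int_norm_lt => //; apply: le_lt_trans yj_le _.
  by apply: lt_le_trans kN; nra.
have kA : r * (r * (mu * `|k|) ^+ A) <= Num.max 1 `|k| ^+ A.
  have -> : Num.max 1 `|k| = `|k| by apply/max_idPr; lra.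
  by rewrite exprMn !mulrA ler_piMl // exprn_ge0.
have mkA0 : 0 <= r * (mu * `|k|) ^+ A by rewrite mulr_ge0 ?exprn_ge0 //; nra.
(* A positive mass is not cancelled by nonnegative weights directly; as [f] is zero-sum, it equals
   negative masses at the same [k] in all other coordinates. *)
case: s; last first.
  apply: pushable_le kA _.
  apply: (pushable_ext (F := fun f => \sum_(j | j != i) - f j k)).
    move=> f f0; rewrite sumrN expr0 mul1r; apply/eqP; rewrite eq_sym -subr_eq0 opprK.
    by have := f0 k; rewrite (bigD1 i) //= => ->.
  apply: (@pushable_le _ (\sum_(j | j != i) r * (mu * `|k|) ^+ A)); last exact: pushable_sum.
  by rewrite sumr_const -mulr_natl ler_wpM2r // ler_nat max_card.
apply: (@pushable_le _ (r * (mu * `|k|) ^+ A)).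
  by apply: le_trans kA; rewrite ler_peMl.
by apply: (pushable_ext _ (neg i)) => f _; rewrite expr1 mulN1r.
Qed.

End Push.

End Weights.

(** * Balanced weights *)

(** Classical: a subspace inside [W] is enlarged by a vector of [W] outside it as long as there is
    one; the dimension bounds the number of steps. *)
Lemma vspace_of_pred (K : fieldType) (vT : vectType K) (W : vT -> Prop) :
    W 0 -> (forall a u v, W u -> W v -> W (a *: u + v)) ->
  exists U : {vspace vT}, forall v, v \in U <-> W v.
Proof.
move=> W0 WD.
suff ext N (U : {vspace vT}) : (forall v, v \in U -> W v) -> (\dim {:vT} <= \dim U + N)%N ->
    exists U : {vspace vT}, forall v, v \in U <-> W v.
  apply: (ext (\dim {:vT}) 0%VS) => [v|]; last exact: leq_addl.
  by rewrite memv0 => /eqP->.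
elim: N U => [|N IHN] U UW dimU.
  exists U => v; split=> [/UW//|_]; rewrite addn0 in dimU.
  have /eqP-> : (U == fullv)%VS by rewrite eqEdim subvf dimU.
  exact: memvf.
have [[v Wv vU]|noW] := pselect (exists2 v, W v & v \notin U); last first.
  exists U => v; split=> [/UW//|Wv]; apply: contrapT => /negP vU.
  by apply: noW; exists v.
apply: (IHN (U + <[v]>)%VS) => [_ /memv_addP[u uU [_ /vlineP[a ->] ->]]|].
  by rewrite addrC; apply: WD => //; apply: UW.
apply: leq_trans dimU _; rewrite addnS -addSn leq_add2r ltnNge; apply: contra vU => dim_le.
have /eqP-> : (U == U + <[v]>)%VS by rewrite eqEdim addvSl dim_le.
by rewrite (subvP (addvSr _ _)) ?memv_line.
Qed.

Section Balance.

Variables (m : nat) (I : finType).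
Local Notation V := 'rV[rat]_m.
Variables (B : V -> V -> rat) (w : I -> V).
Local Notation pairing := (pairing B w).
Local Notation lattice := (lattice B w).

Definition in_lattice (om : seq (rat * V)) := {in om, forall p, p.2 \in lattice}.

Lemma pairing_cat om om' f : pairing (om ++ om') f = pairing om f + pairing om' f.
Proof. by rewrite /pairing big_cat. Qed.

Lemma pairing_scale a om f :
  pairing [seq (a * p.1, p.2) | p <- om] f = a * pairing om f.
Proof. by rewrite /pairing big_map mulr_sumr; apply: eq_bigr => p _; rewrite mulrA. Qed.

Lemma pairing_flatten oms f : pairing (flatten oms) f = \sum_(om <- oms) pairing om f.
Proof. by rewrite /pairing big_flatten. Qed.

(* Only finitely many values of size at most [L] are involved: the defects that
   are realized by lattice points form a finite dimensional space. *)
Lemma finite_presentation (L : nat) :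
  exists2 X0 : seq V, {subset X0 <= lattice} & exists2 C, 0 <= C &
  forall de om, bounded_defect L%:R de -> in_lattice om ->
    (forall f, zero_sum f -> defect de f = pairing om f) ->
  exists om', [/\ {in om', forall p, p.2 \in X0},
    \sum_(p <- om') `|p.1| <= C * \sum_(p <- de) `|p.1| &
    forall f, zero_sum f -> defect de f = pairing om' f].
Proof.
pose T : finType := (I * 'I_(2 * L).+1)%type; pose k := #|T|.
pose pos (u : 'I_k) : rat := (enum_val u).2%:R - L%:R.
pose vect (d : 'rV[rat]_k) (f : I -> rat -> rat) := \sum_u d 0 u * f (enum_val u).1 (pos u).
(* The defects realizable with weights of any sign form a rational subspace. One realization is
   fixed for each basis vector, and [X0] collects the points used. *)
pose W d := exists2 om, in_lattice om & forall f, zero_sum f -> vect d f = pairing om f.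
have [||U UW] := @vspace_of_pred _ _ W.
- exists [::] => // f _; rewrite /vect /pairing big_nil big1 // => u _.
  by rewrite mxE mul0r.
- move=> a d d' [om omL dom] [om' om'L d'om'].
  exists ([seq (a * p.1, p.2) | p <- om] ++ om') => [p|f f0].
    by rewrite mem_cat => /orP[/mapP[q q_om ->]|/om'L//]; apply: (omL q).
  rewrite pairing_cat pairing_scale -dom // -d'om' // /vect mulr_sumr -big_split /=.
  by apply: eq_bigr => u _; rewrite !mxE mulrDl mulrA.
pose b := vbasis U.
have bW (i : 'I_(\dim U)) : exists om, in_lattice om /\ forall f, zero_sum f -> vect b`_i f = pairing om f.
  have /UW[om omL bom] : b`_i \in U by apply: vbasis_mem; rewrite mem_nth ?size_tuple.
  by exists om.
have [om omP] := fin_all_exists bW.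
pose X0 := flatten [seq [seq p.2 | p <- om i] | i <- enum 'I_(\dim U)].
exists X0 => [y /flattenP[_ /mapP[i _ ->] /mapP[p p_om ->]]|].
  by have [omL _] := omP i; apply: omL.
(* A bound for the [i]-th basis coordinate on vectors with entries at most 1, independent of the
   defect. *)
pose c i := \sum_u `|coord b i (delta_mx 0 u)|.
pose e i := \sum_(p <- om i) `|p.1|.
exists (\sum_i c i * e i) => [|de om0 de_bd om0L de_om0].
  by apply: sumr_ge0 => i _; rewrite mulr_ge0 ?sumr_ge0.
pose d : 'rV[rat]_k := \row_u \sum_(p <- de | (p.2.1 == (enum_val u).1) && (p.2.2 == pos u)) p.1.
pose N := \sum_(p <- de) `|p.1|.
have d_le u : `|d 0 u| <= N.
  rewrite mxE; apply: le_trans (ler_norm_sum _ _ _) _; rewrite big_mkcond /=.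
  by apply: ler_sum => p _; case: ifP.
have vectE f : vect d f = defect de f.
  rewrite /vect /defect; under eq_bigr do rewrite mxE mulr_suml.
  rewrite (exchange_big_dep xpredT) //= [LHS]big_seq [RHS]big_seq; apply: eq_bigr => p p_de.
  have [p_int p_le] := de_bd p p_de.
  have pN : p.2.2 + L%:R \is a Num.nat.
    rewrite natrEint; apply/andP; split; first by rewrite rpredD ?natr_int.
    by move: p_le; rewrite ler_norml => /andP[h1 h2]; lra.
  have [q Dq] := natrP pN.
  have lt_q : (q < (2 * L).+1)%N.
    rewrite ltnS -(ler_nat rat) -Dq natrM; move: p_le; rewrite ler_norml => /andP[h1 h2]; lra.
  rewrite (big_pred1 (enum_rank ((p.2.1, Ordinal lt_q) : T))) => [|u /=].
    by rewrite /pos enum_rankK /= -Dq addrK.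
  have -> : (u == enum_rank ((p.2.1, Ordinal lt_q) : T)) = (enum_val u == (p.2.1, Ordinal lt_q)).
    by rewrite -[in RHS](inj_eq enum_rank_inj) enum_valK.
  rewrite -pair_eqE /= eq_sym; congr (_ && _).
  by rewrite /pos -(inj_eq (addIr L%:R)) subrK Dq eqr_nat eq_sym.
have dU : d \in U by apply/UW; exists om0 => // f f0; rewrite vectE de_om0.
exists (flatten [seq [seq (coord b i d * p.1, p.2) | p <- om i] | i <- enum 'I_(\dim U)]); split.
- move=> _ /flattenP[_ /mapP[i i_U ->] /mapP[p p_om ->]] /=.
  by apply/flattenP; exists [seq p.2 | p <- om i]; apply: map_f.
- rewrite big_flatten big_map big_enum /= mulr_suml; apply: ler_sum => i _.
  rewrite big_map /=; under eq_bigr do rewrite normrM.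
  rewrite -mulr_sumr mulrAC -/(e i); apply: ler_wpM2r; first by rewrite sumr_ge0.
  rewrite {1}(row_sum_delta d) linear_sum /= mulr_suml.
  apply: le_trans (ler_norm_sum _ _ _) _; apply: ler_sum => u _.
  by rewrite linearZ /= normrM mulrC ler_wpM2l.
move=> f f0; rewrite pairing_flatten big_map big_enum /= -vectE.
have dE u : d 0 u = \sum_i coord b i d * b`_i 0 u.
  rewrite [in LHS](coord_vbasis dU) summxE; apply: eq_bigr => i _.
  by rewrite mxE.
transitivity (\sum_u \sum_i coord b i d * b`_i 0 u * f (enum_val u).1 (pos u)).
  by apply: eq_bigr => u _; rewrite dE mulr_suml.
rewrite exchange_big /=; apply: eq_bigr => i _.
have [_ /(_ f f0) bE] := omP i; rewrite pairing_scale -bE /vect mulr_sumr.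
by apply: eq_bigr => u _; rewrite mulrA.
Qed.

Hypothesis BDl : forall x y z, B (x + y) z = B x z + B y z.
Hypothesis BZl : forall c x z, B (c *: x) z = c * B x z.
Hypothesis BC : forall x y, B x y = B y x.
Hypothesis B_ge0 : forall x, 0 <= B x x.
Hypothesis B_w : forall i, B (w i) (w i) = 1.
Hypothesis w_coord : forall j : 'I_m, exists i, forall y : V, y 0 j = B (w i) y.
Hypothesis lattice_onto : forall i, exists2 h, h \in lattice & B (w i) h = 1.
Variable lam : rat.
Hypothesis lam_ge0 : 0 <= lam.
Hypothesis lam_lt1 : lam < 1.
Hypothesis strict : forall i, exists2 p, B (w i) p = 1 &
  forall j, j != i -> `|B (w j) p| <= lam.
Variable i0 : I.

Definition weight (om : seq (rat * V)) (y : V) := \sum_(p <- om | p.2 == y) p.1.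

Definition int_range (R : nat) : seq rat := [seq k%:R - R%:R | k <- iota 0 (2 * R).+1].

Lemma mem_int_range R k : k \is a Num.int -> `|k| <= R%:R -> k \in int_range R.
Proof.
move=> kZ k_le; have kN : k + R%:R \is a Num.nat.
  rewrite natrEint; apply/andP; split; first by rewrite rpredD ?natr_int.
  by move: k_le; rewrite ler_norml => /andP[h1 h2]; lra.
have [q Dq] := natrP kN; apply/mapP; exists q; last by rewrite -Dq addrK.
rewrite mem_iota /= add0n ltnS -(ler_nat rat) -Dq natrM.
by move: k_le; rewrite ler_norml => /andP[h1 h2]; lra.
Qed.

Lemma int_range_uniq R : uniq (int_range R).
Proof.
rewrite map_inj_uniq ?iota_uniq // => k k' /addIr/eqP.
by rewrite eqr_nat => /eqP.
Qed.

Lemma int_rangeP R k : k \in int_range R -> k \is a Num.int /\ `|k| <= R%:R.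
Proof.
case/mapP=> q; rewrite mem_iota /= add0n ltnS -(ler_nat rat) natrM => le_q ->.
split; first by rewrite rpredB ?natr_int.
by have := ler0n rat q; rewrite ler_norml => q0; apply/andP; split; lra.
Qed.

Definition cutoff_weights n R : seq (rat * V) :=
  [seq (cutoff B n.+1 R y, y) | y <- grid m 1 R & y \in lattice].

(** For zero-sum [f] the slice sums of the reference coordinate [i0] can be subtracted freely,
    leaving only the small differences between slices. Values beyond [R] do not occur because the
    functionals have norm 1. *)
Lemma cutoff_weights_pairing n R f : zero_sum f ->
  pairing (cutoff_weights n R) f =
  \sum_i \sum_(k <- int_range R)
    (slice_sum B lattice n (B (w i)) R k 0 - slice_sum B lattice n (B (w i0)) R k 0) * f i k.
Proof.
move=> f0.
have slE i k : slice_sum B lattice n (B (w i)) R k 0 =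
    \sum_(y <- grid m 1 R) ((y \in lattice) && (B (w i) y == k))%:R * cutoff B n.+1 R y.
  rewrite /slice_sum (@fsumE _ (grid m 1 R)) ?grid_uniq //.
    by apply: eq_bigr => y _; rewrite addr0.
  move=> y; have := @slice_sum_cover m B lattice (coord_bound BDl BZl BC B_ge0 B_w w_coord)
    (lattice_int w_coord) n (fun y => B (w i) y == k) 0 R 0 y.
  by rewrite addn0; apply => j; rewrite mxE normr0.
transitivity (\sum_i \sum_(k <- int_range R) slice_sum B lattice n (B (w i)) R k 0 * f i k).
  rewrite /pairing big_map big_filter big_mkcond /=.
  under [RHS]eq_bigr => i _ do under eq_bigr => k _ do rewrite slE mulr_suml.
  under [RHS]eq_bigr => i _ do rewrite exchange_big /=.
  rewrite [RHS]exchange_big /=; apply: eq_bigr => y _.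
  case: ifP => yL; last by rewrite big1 // => i _; rewrite big1 // => k _; rewrite !mul0r.
  rewrite mulr_sumr; apply: eq_bigr => i _.
  have [->|y_cutoff] := eqVneq (cutoff B n.+1 R y) 0.
    by rewrite mul0r big1 // => k _; rewrite mulr0 mul0r.
  rewrite (bigD1_seq (B (w i) y)) ?int_range_uniq //=.
    rewrite eqxx mul1r big1_seq ?addr0 // => k /andP[ki _].
    by rewrite eq_sym (negPf ki) !mul0r.
  apply: mem_int_range; first by move/latticeP: yL.
  rewrite -(@ler_pXn2r _ 2) ?nnegrE ?ler0n // real_normK ?num_real //.
  apply: le_trans (l_bound BDl BZl BC B_ge0 B_w _ _) _.
  by apply: ltW; apply: cutoff_neq0 y_cutoff.
apply/eqP; rewrite -subr_eq0 -sumrB; apply/eqP.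
rewrite (eq_bigr (fun i => \sum_(k <- int_range R) slice_sum B lattice n (B (w i0)) R k 0 * f i k)).
  rewrite exchange_big /= big1 // => k _; rewrite -mulr_sumr.
  by have := f0 k => ->; rewrite mulr0.
by move=> i _; rewrite -sumrB; apply: eq_bigr => k _; ring.
Qed.

Lemma weight_cat om om' y : weight (om ++ om') y = weight om y + weight om' y.
Proof. by rewrite /weight big_cat. Qed.

Lemma weight_cutoff n R y :
  weight (cutoff_weights n R) y = (y \in lattice)%:R * cutoff B n.+1 R y.
Proof.
rewrite /weight big_map big_filter_cond /=.
have [yL|yL] := boolP (y \in lattice); last first.
  rewrite mul0r big1 // => z /andP[zL /eqP zy].
  by rewrite zy (negPf yL) in zL.
rewrite mul1r (eq_bigl (fun z => z == y)) => [|z]; last by case: eqP => [->|]; rewrite ?yL ?andbF.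
rewrite big_mkcond; have [yG|yG] := boolP (y \in grid m 1 R).
  rewrite (bigD1_seq y) ?grid_uniq //= eqxx big1 ?addr0 // => z.
  by move/negPf->.
rewrite big1_seq => [|z /andP[_ zG]]; last by case: eqP => // zy; rewrite -zy zG in yG.
apply/eqP; rewrite eq_sym; apply: contraNT yG => y_cutoff.
apply: mem_grid => // [|j]; first by rewrite scale1r; exact: (lattice_int w_coord).
exact: (cutoff_coord (coord_bound BDl BZl BC B_ge0 B_w w_coord) j y_cutoff).
Qed.

Lemma cutoff_weights_lattice n R : in_lattice (cutoff_weights n R).
Proof. by move=> p /mapP[y + ->]; rewrite mem_filter => /andP[]. Qed.

Lemma cutoff_weights_pushable : exists L A : nat, forall n, exists2 K, 0 <= K &
  forall R, (0 < R)%N ->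
  pushable B w L%:R (K * R%:R ^+ (m + n.+1 + A.+1)) (pairing (cutoff_weights n R)).
Proof.
have I_gt0 : (0 < #|I|)%N by apply/card_gt0P; exists i0.
have [L [A push]] := pushable_unit BDl BZl BC lattice_onto lam_lt1 strict lam_ge0 I_gt0.
exists L, A => n.
have [C C0 close] := slices_close BDl BZl BC B_ge0 B_w w_coord lattice_onto n.
exists (#|I|%:R * 3 * C) => [|R R_gt0]; first by rewrite !mulr_ge0 ?ler0n.
set r : rat := R%:R; have r1 : 1 <= r by rewrite ler1n.
have r0 : 0 <= r by lra.
pose e : rat := C * r ^+ (m + n.+1); have e0 : 0 <= e by rewrite mulr_ge0 ?exprn_ge0.
(* Filtering by membership gives every summand access to the bound on [k]. *)
apply: (pushable_ext (F := fun f => \sum_i \sum_(k <- int_range R | k \in int_range R)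
  (slice_sum B lattice n (B (w i)) R k 0 - slice_sum B lattice n (B (w i0)) R k 0) * f i k)).
  by move=> f f0; rewrite cutoff_weights_pairing //; apply: eq_bigr => i _; rewrite -big_seq.
apply: (@pushable_le _ _ _ _ _ (\sum_(i : I) \sum_(k <- int_range R | k \in int_range R) e * r ^+ A)).
  rewrite sumr_const -big_seq big_const_seq count_predT iter_addr_0 size_map size_iota.
  rewrite -mulrnA -[X in X <= _]mulr_natr exprD exprSr.
  have -> : #|I|%:R * 3 * C * (r ^+ (m + n.+1) * (r ^+ A * r)) = e * r ^+ A * (#|I|%:R * 3 * r).
    by rewrite /e; ring.
  apply: ler_wpM2l; first by rewrite mulr_ge0 ?exprn_ge0.
  by rewrite (_ : #|xpredT| = #|I|) // /r -!natrM ler_nat mulnC -mulnA leq_mul2l mulSn -add1n leq_add2r R_gt0 orbT.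
apply: pushable_sum => i _; apply: pushable_sum => k k_R.
have [kZ k_le] := int_rangeP k_R.
set eta := _ - _; have eta_le : `|eta| <= e := close i i0 R k R_gt0.
have signE (f : I -> rat -> rat) : zero_sum f ->
    `|eta| * ((-1) ^+ (eta < 0)%R * f i k) = eta * f i k.
  by move=> _; rewrite mulrA [_ * _ ^+ _]mulrC -numEsign.
apply: (pushable_ext signE).
apply: (@pushable_le _ _ _ _ _ (`|eta| * Num.max 1 `|k| ^+ A)).
  apply: ler_pM => //; first by rewrite exprn_ge0 // le_max ler01.
  by apply: lerXn2r; rewrite ?nnegrE ?le_max ?ler01 // ge_max r1.
by apply: pushableZ => //; apply: push.
Qed.

(** The cutoff weights plus the pushing points leave a bounded defect, realized by signed weights on
    the fixed finite set [X0]. Subtracting these balances the family, and on [X0] the cutoff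
    outweighs what is subtracted. *)
Theorem balanced_exists : exists om, [/\ in_lattice om, forall y, 0 <= weight om y,
  exists2 y, 0 < weight om y & B (w i0) y = 1 & forall f, zero_sum f -> pairing om f = 0].
Proof.
have [L [A push]] := cutoff_weights_pushable.
have [X0 X0L [C C0 CP]] := finite_presentation L.
have [h hL wh] := lattice_onto i0.
(* With this [n] the cutoff, of order [R^(2(n+1))], exceeds the defect by exactly one power of
   [R]. *)
have [n dbl] : exists n, (2 * n.+1 = (m + n.+1 + A.+1).+1)%N by exists (m + A.+1)%N; rewrite mul2n -addnn addnAC.
have [K K0 {}push] := push n.
(* On these points the cutoff is at least [(R^2 / 2)^(n+1)]; the last condition absorbs the
   constants and this power of 2. Including [h] guarantees a point of positive weight whose
   coordinate [i0] is 1. *)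
have [R [R_gt0 R_big R_CK]] : exists R : nat, [/\ (0 < R)%N,
   forall y, y \in h :: X0 -> 2 * B y y <= R%:R ^+ 2 & C * K * 2 ^+ n.+1 < R%:R].
  pose Y := \sum_(y <- h :: X0) 2 * B y y; pose Z := C * K * 2 ^+ n.+1.
  have Y0 : 0 <= Y by apply: sumr_ge0 => y _; rewrite mulr_ge0.
  have Z0 : 0 <= Z by rewrite !mulr_ge0 ?exprn_ge0.
  exists (Num.bound (Y + Z)).+1.
  have : Y + Z < (Num.bound (Y + Z)).+1%:R.
    by apply: lt_trans (archi_boundP (addr_ge0 Y0 Z0)) _; rewrite ltr_nat.
  have r1 : 1 <= (Num.bound (Y + Z)).+1%:R :> rat by rewrite ler1n.
  move: (Num.bound _).+1%:R r1 => r r1 YZr.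
  split=> // [y yX|]; last by rewrite -/Z; apply: le_lt_trans YZr; rewrite lerDr.
  apply: (@le_trans _ _ Y); last by apply: (@le_trans _ _ r); [lra | nra].
  rewrite /Y (big_rem y) //= lerDl; apply: sumr_ge0 => z _.
  by rewrite mulr_ge0.
have [om [de [om0 de_bd de_le E]]] := push R R_gt0.
have omL : in_lattice om by move=> p /om0[].
have bomL : in_lattice (cutoff_weights n R ++ om).
  by move=> p; rewrite mem_cat => /orP[/cutoff_weights_lattice|/omL].
have [f f0|om' [om'X om'_le E']] := CP de (cutoff_weights n R ++ om) de_bd bomL.
  by rewrite pairing_cat E.
set N := \sum_(p <- de) `|p.1| in de_le om'_le.
have om_ge0 y : 0 <= weight om y.
  by rewrite /weight big_seq_cond sumr_ge0 // => p /andP[/om0[]].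
have om'_weight y : `|weight om' y| <= C * N.
  apply: le_trans om'_le; apply: le_trans (ler_norm_sum _ _ _) _.
  by rewrite big_mkcond /=; apply: ler_sum => p _; case: ifP.
pose Om := (cutoff_weights n R ++ om) ++ [seq (-1 * p.1, p.2) | p <- om'].
have OmE y : weight Om y = (y \in lattice)%:R * cutoff B n.+1 R y + weight om y - weight om' y.
  rewrite !weight_cat weight_cutoff; congr (_ + _).
  by rewrite /weight big_map /= -mulr_sumr mulN1r.
have big_pos y : y \in h :: X0 -> 0 < weight Om y.
  move=> yX; have yL : y \in lattice by move: yX; rewrite inE => /predU1P[->|/X0L].
  rewrite OmE yL mul1r; have := om_ge0 y; have := om'_weight y; rewrite ler_norml.
  suff cutoff_gt : C * N < cutoff B n.+1 R y by move=> /andP[_ h1] h2; lra.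
  set r : rat := R%:R; have r_gt0 : 0 < r by rewrite ltr0n.
  have yR := R_big y yX; rewrite -/r in yR.
  apply: (@lt_le_trans _ _ ((r ^+ 2 / 2) ^+ n.+1)); last first.
    have le2 : r ^+ 2 / 2 <= r ^+ 2 - B y y by lra.
    have ge0 : 0 <= r ^+ 2 / 2 by rewrite divr_ge0 ?sqr_ge0.
    by rewrite /cutoff; apply: lerXn2r; rewrite ?nnegrE ?le_max ?lexx ?le2 ?orbT.
  apply: (@le_lt_trans _ _ (C * (K * r ^+ (m + n.+1 + A.+1)))).
    by apply: ler_wpM2l.
  rewrite expr_div_n ltr_pdivlMr ?exprn_gt0 // -exprM.
  rewrite dbl [ltRHS]exprSr.
  have -> : C * (K * r ^+ (m + n.+1 + A.+1)) * 2 ^+ n.+1 =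
    r ^+ (m + n.+1 + A.+1) * (C * K * 2 ^+ n.+1) by ring.
  by rewrite ltr_pM2l // exprn_gt0.
exists Om; split=> [p|y||f f0].
- rewrite mem_cat => /orP[/bomL//|/mapP[q q_om' ->]] /=.
  by apply: X0L; apply: om'X.
- have [yX|yX] := boolP (y \in X0); first by apply: ltW; apply: big_pos; rewrite inE yX orbT.
  have -> : weight Om y = (y \in lattice)%:R * cutoff B n.+1 R y + weight om y.
    rewrite OmE [weight om' y]big_seq_cond big1 ?subr0 // => p /andP[/om'X pX /eqP py].
    by rewrite py (negPf yX) in pX.
  by rewrite addr_ge0 // mulr_ge0 // cutoff_ge0.
- by exists h => //; apply: big_pos; rewrite mem_head.
by rewrite pairing_cat pairing_cat pairing_scale E // E' // mulN1r subrr.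
Qed.

End Balance.

(** * From weights to permutations *)

Lemma big_option (R : nmodType) (T : finType) (F : option T -> R) :
  \sum_i F i = F None + \sum_j F (Some j).
Proof.
rewrite (bigD1 None) //=; congr (_ + _).
rewrite (reindex_omap Some id) => [|[j|] //]; apply: eq_bigl => j.
by rewrite eqxx.
Qed.

Definition permuted_relation (I : finType) (a : I -> rat) :=
  exists N (s : I -> 'S_N) (x : 'I_N -> rat), (exists k, x k != 0) /\
    forall k, \sum_i a i * x (s i k) = 0.

Section Permutations.

Variables (m : nat) (I : finType).
Local Notation V := 'rV[rat]_m.
Variables (B : V -> V -> rat) (w : I -> V).

Lemma sum_weight om (g : V -> rat) :
  \sum_(y <- undup (unzip2 om)) weight om y * g y = \sum_(p <- om) p.1 * g p.2.
Proof.
rewrite /weight; under eq_bigr do rewrite mulr_suml.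
rewrite (exchange_big_dep xpredT) //= [LHS]big_seq [RHS]big_seq; apply: eq_bigr => p p_om.
rewrite big_mkcond (bigD1_seq p.2) ?undup_uniq ?mem_undup ?map_f //= eqxx.
by rewrite big1 ?addr0 // => y; rewrite eq_sym => /negPf->.
Qed.

(** After clearing denominators the weights become multiplicities in a list [Y]. All coordinate
    lists of [Y] are rearrangements of the one for [i0], which serves as [x]. *)
Lemma balanced_permuted (a : I -> rat) (i0 : I) om :
    (forall y, \sum_i a i * B (w i) y = 0) ->
    (forall y, 0 <= weight om y) -> (exists2 y, 0 < weight om y & B (w i0) y = 1) ->
    (forall f, zero_sum f -> pairing B w om f = 0) ->
  permuted_relation a.
Proof.
move=> aw om0 [y0 y0_gt0 wy0] om_bal.
pose pts := undup (unzip2 om).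
have [D D_gt0 DP] := common_denominator (fun u : 'I_(size pts) => weight om (nth 0 pts u)).
pose mu y := Num.truncn (weight om y *+ D).
have muE y : y \in pts -> (mu y)%:R = weight om y *+ D.
  move=> y_pts; rewrite truncnK // natrEint mulrn_wge0 // andbT.
  have lt_y : (index y pts < size pts)%N by rewrite index_mem.
  by have := DP (Ordinal lt_y); rewrite /= nth_index.
pose Y := flatten [seq nseq (mu y) y | y <- pts].
have countY i k : (count_mem k [seq B (w i) y | y <- Y])%:R =
    D%:R * \sum_(p <- om) p.1 * (B (w i) p.2 == k)%:R :> rat.
  rewrite -(sum_weight om (fun y => (B (w i) y == k)%:R)) mulr_sumr.
  rewrite /Y map_flatten count_flatten -!map_comp sumnE big_map natr_sum.
  rewrite [LHS]big_seq [RHS]big_seq; apply: eq_bigr => y y_pts.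
  by rewrite /= map_nseq count_nseq /= natrM muE // -(mulr_natl (weight om y)); ring.
have row_perm i : perm_eq [seq B (w i) y | y <- Y] [seq B (w i0) y | y <- Y].
  apply/allP => k _ /=; rewrite -(eqr_nat rat) !countY; apply/eqP; congr (_ * _).
  (* This zero-sum test function compares how often [i] and [i0] take the value [k]. *)
  pose f j l : rat := ((j == i)%:R - (j == i0)%:R) * (l == k)%:R.
  have f0 : zero_sum f.
    move=> l; rewrite /f -mulr_suml sumrB (bigD1 i) //= eqxx big1 => [|j /negPf-> //].
    by rewrite (bigD1 i0) //= eqxx big1 ?subrr ?mul0r // => j /negPf->.
  apply/eqP; rewrite -subr_eq0 -sumrB -[X in _ == X](om_bal f f0) /pairing; apply/eqP.
  apply: eq_bigr => p _; rewrite -mulrBr; congr (_ * _); rewrite /f.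
  under [RHS]eq_bigr do rewrite mulrBl; rewrite sumrB.
  rewrite (bigD1 i) //= eqxx mul1r big1 ?addr0 => [|j /negPf->]; last by rewrite mul0r.
  rewrite (bigD1 i0) //= eqxx mul1r big1 ?addr0 // => j /negPf->; last by rewrite mul0r.
pose t := [tuple of [seq B (w i0) y | y <- in_tuple Y]].
have sP i : exists s : 'S_(size Y), [seq B (w i) y | y <- Y] = [tuple tnth t (s k) | k < size Y].
  exact/tuple_permP/row_perm.
have [s sE] := fin_all_exists sP; exists (size Y), s, (tnth t); split=> [|k].
  have y0Y : y0 \in Y.
    have y0_pts : y0 \in pts.
      rewrite mem_undup; apply: contraLR y0_gt0 => y0_om; rewrite -leNgt /weight.
      rewrite big_seq_cond big1 // => p /andP[p_om /eqP py0].
      by rewrite -py0 map_f in y0_om.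
    apply/flattenP; exists (nseq (mu y0) y0); first exact: map_f.
    rewrite mem_nseq eqxx andbT -(ltr_nat rat) muE //.
    by rewrite pmulrn_lgt0.
  have /tnthP[k tk] : 1 \in t by apply/mapP; exists y0; rewrite ?wy0.
  by exists k; rewrite -tk oner_neq0.
rewrite -[RHS](aw (tnth (in_tuple Y) k)); apply: eq_bigr => i _; congr (_ * _).
transitivity (nth 0 [seq B (w i) y | y <- Y] k).
  transitivity (tnth [tuple tnth t (s i j) | j < size Y] k); first by rewrite tnth_mktuple.
  by rewrite (tnth_nth 0) -sE.
by rewrite (nth_map 0) // -(tnth_nth 0 (in_tuple Y)).
Qed.

End Permutations.

(** * The form dual to a rank one perturbation of a diagonal matrix *)

Section RankOneForm.

Variables (m : nat) (d v : 'I_m -> rat) (c : rat).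
Local Notation V := 'rV[rat]_m.
Hypothesis d_gt0 : forall j, 0 < d j.
Local Notation Q := (\sum_j v j ^+ 2 / d j).
Hypothesis cQ_gt0 : 0 < 1 + c * Q.

Definition diag_form (x y : V) := \sum_j x 0 j * y 0 j / d j.

(** The Sherman-Morrison formula for the inverse of [diag d + c v v^T]. *)
Definition rank_one_form (x y : V) :=
  diag_form x y - c / (1 + c * Q) * (diag_form (\row_j v j) x * diag_form (\row_j v j) y).

(** The product [(diag d + c v v^T) xi], which represents the functional [xi] through the form. *)
Definition rank_one_dual (xi : 'I_m -> rat) : V :=
  \row_j (d j * xi j + c * v j * \sum_k v k * xi k).

Lemma diag_formDl x y z : diag_form (x + y) z = diag_form x z + diag_form y z.
Proof. by rewrite /diag_form -big_split /=; apply: eq_bigr => j _; rewrite !mxE !mulrDl. Qed.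

Lemma diag_formZl a x z : diag_form (a *: x) z = a * diag_form x z.
Proof. by rewrite /diag_form mulr_sumr; apply: eq_bigr => j _; rewrite !mxE !mulrA. Qed.

Lemma diag_formC x y : diag_form x y = diag_form y x.
Proof. by apply: eq_bigr => j _; rewrite [x 0 j * _]mulrC. Qed.

Lemma diag_form_ge0 x : 0 <= diag_form x x.
Proof.
apply: sumr_ge0 => j _; rewrite divr_ge0 ?(ltW (d_gt0 j)) //.
by rewrite -expr2 sqr_ge0.
Qed.

Lemma rank_one_formDl x y z : rank_one_form (x + y) z = rank_one_form x z + rank_one_form y z.
Proof. by rewrite /rank_one_form !(diag_formC _ (x + y)) !diag_formDl !(diag_formC _ (\row_j v j)); ring. Qed.

Lemma rank_one_formZl a x z : rank_one_form (a *: x) z = a * rank_one_form x z.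
Proof. by rewrite /rank_one_form !(diag_formC _ (a *: x)) !diag_formZl !(diag_formC _ (\row_j v j)); ring. Qed.

Lemma rank_one_formC x y : rank_one_form x y = rank_one_form y x.
Proof. by rewrite /rank_one_form diag_formC; congr (_ - _ * _); rewrite mulrC. Qed.

Lemma diag_form_v : diag_form (\row_j v j) (\row_j v j) = Q.
Proof. by apply: eq_bigr => j _; rewrite !mxE expr2. Qed.

(** Over the denominator [1 + c Q] the numerator is [(1 + c Q) X - c Y], where [Y <= Q X] by
    Cauchy-Schwarz. For [c >= 0] this inequality suffices; for [c < 0] both terms are
    nonnegative. *)
Lemma rank_one_form_ge0 x : 0 <= rank_one_form x x.
Proof.
have cQ0 := cQ_gt0.
have Q0 : 0 <= Q by rewrite -diag_form_v diag_form_ge0.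
have := form_Cauchy_Schwarz diag_formDl diag_formZl diag_formC diag_form_ge0 (\row_j v j) x.
rewrite diag_form_v /rank_one_form expr2.
move: (diag_form_ge0 x) (sqr_ge0 (diag_form (\row_j v j) x)); rewrite expr2.
move: Q cQ0 Q0 (diag_form x x) (_ * _) => q cq0 q0 X Y X0 Y0 YX.
have -> : X - c / (1 + c * q) * Y = ((1 + c * q) * X - c * Y) / (1 + c * q).
  by field; rewrite gt_eqF.
apply: divr_ge0; last exact: ltW.
by have [c0|c0] := lerP 0 c; nra.
Qed.

Lemma rank_one_dualE xi y : rank_one_form (rank_one_dual xi) y = \sum_j xi j * y 0 j.
Proof.
have nz := gt_eqF cQ_gt0; pose S := \sum_k v k * xi k; pose Y := diag_form (\row_j v j) y.
have -> : rank_one_form (rank_one_dual xi) y =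
    diag_form (rank_one_dual xi) y - c / (1 + c * Q) * (diag_form (\row_j v j) (rank_one_dual xi) * Y) by [].
have -> : diag_form (rank_one_dual xi) y = \sum_j xi j * y 0 j + c * S * Y.
  rewrite /diag_form /Y mulr_sumr -big_split /=; apply: eq_bigr => j _.
  by rewrite !mxE -/S; field; rewrite gt_eqF.
have -> : diag_form (\row_j v j) (rank_one_dual xi) = S + c * S * Q.
  rewrite /diag_form mulr_sumr {1}/S -big_split /=; apply: eq_bigr => j _.
  by rewrite !mxE -/S; field; rewrite gt_eqF.
by move: Q nz => q nz; field; rewrite nz.
Qed.

End RankOneForm.

(** * Coefficients satisfying the strict polygon inequality *)

Section Polygon.

Variables (m : nat) (a : option 'I_m -> rat).
Local Notation V := 'rV[rat]_m.
Hypothesis a_neq0 : forall i, a i != 0.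
Hypothesis a_max : forall j, `|a (Some j)| <= `|a None|.
Hypothesis a_lt : `|a None| < \sum_j `|a (Some j)|.

(* In terms of coordinates [y_j], [j != None], of the hyperplane, the matrix of the
   dual form is [diag d + c v v^T]; the conditions say that the functionals [y_j]
   and [- (\sum_j a_j y_j) / a None] have norm 1. *)
Lemma polygon_form : exists (d v : 'I_m -> rat) c, [/\ forall j, 0 < d j,
  0 < 1 + c * (\sum_j v j ^+ 2 / d j), forall j, d j + c * v j ^+ 2 = 1 &
  \sum_j d j * a (Some j) ^+ 2 + c * (\sum_j v j * a (Some j)) ^+ 2 = a None ^+ 2].
Proof.
pose b j := a (Some j); pose t j := b j ^+ 2; pose s := \sum_j t j; pose t1 := a None ^+ 2.
have t_gt0 j : 0 < t j by rewrite exprn_even_gt0 //= a_neq0.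
have t1_gt0 : 0 < t1 by rewrite exprn_even_gt0 //= a_neq0.
have t_le j : t j <= t1.
  rewrite /t /t1 -[b j ^+ 2]real_normK ?num_real // -[a None ^+ 2]real_normK ?num_real //.
  by apply: lerXn2r; rewrite ?nnegrE ?normr_ge0 ?a_max.
(* For [s <= t1] the dual form interpolates between the identity, with value [s] on the coefficients
   [b], and the square of the signed sum, with value [S^2 > t1]; [lam] makes the value [t1]. *)
have [s_le|s_gt] := leP s t1.
  pose S := \sum_j `|b j|.
  have St : t1 < S ^+ 2.
    rewrite /t1 -[a None ^+ 2]real_normK ?num_real //.
    by apply: ltrXn2r; rewrite ?nnegrE ?normr_ge0 // (le_trans _ (ltW a_lt)).
  pose lam := (S ^+ 2 - t1) / (S ^+ 2 - s).
  have lam_gt0 : 0 < lam by rewrite divr_gt0 ?subr_gt0 // (le_lt_trans s_le).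
  have lam_le1 : lam <= 1 by rewrite ler_pdivrMr ?mul1r ?lerB // subr_gt0 (le_lt_trans s_le).
  exists (fun=> lam), (fun j => Num.sg (b j)), (1 - lam); split=> // [|j|].
  - apply: (@lt_le_trans _ _ 1) => //; rewrite lerDl mulr_ge0 ?subr_ge0 //.
    by rewrite sumr_ge0 // => j _; rewrite divr_ge0 ?sqr_ge0 // ltW.
  - by rewrite sqr_sg a_neq0 mulr1 addrC subrK.
  have -> : \sum_j Num.sg (b j) * a (Some j) = S.
    by apply: eq_bigr => j _; rewrite -normrEsg.
  rewrite -mulr_sumr -/t1 -[\sum_j _]/s.
  have : lam * (S ^+ 2 - s) = S ^+ 2 - t1.
    by rewrite divfK // gt_eqF // subr_gt0 (le_lt_trans s_le).
  have alg (x S2 s' t' : rat) : x * (S2 - s') = S2 - t' -> x * s' + (1 - x) * S2 = t'.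
    by move=> E; lra.
  exact: alg.
(* As no [|b j|] exceeds [|a None|], the strict inequality forces at least two indices. *)
have other j : t j < s.
  have : 0 < \sum_(k | k != j) `|b k|.
    by have := a_lt; rewrite (bigD1 j) //=; have := a_max j; rewrite /b; lra.
  have [k kj|none] := pickP (fun k => k != j); last by rewrite big_pred0.
  move=> _; rewrite /s (bigD1 j) //= ltrDl (bigD1 k) //=.
  by rewrite ltr_wpDr // sumr_ge0 // => l _; rewrite ltW.
have [j0 _|none] := pickP (xpredT : pred 'I_m); last first.
  by have := s_gt; rewrite /s big_pred0 // ltNge (ltW t1_gt0).
pose u := s ^+ 2 - \sum_j t j ^+ 2.
have uE : u = \sum_j t j * (s - t j).
  rewrite /u expr2 {1}/s mulr_suml -sumrB; apply: eq_bigr => j _; ring.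
have u_gt0 : 0 < u.
  have pos j : 0 < t j * (s - t j) by apply: mulr_gt0; rewrite ?subr_gt0.
  rewrite uE (bigD1 j0) //= ltr_wpDr // sumr_ge0 // => j _; exact: ltW.
have u_ge : s * (s - t1) <= u.
  rewrite uE /s mulr_suml; apply: ler_sum => j _.
  by apply: ler_wpM2l; [exact: ltW | rewrite lerD2l lerN2 t_le].
(* For [s > t1] the dual matrix has diagonal entries 1 and off-diagonal entries [- c * b j * b k].
   Its value on [b] is [s - c * u], which must be [t1]; the lower bound for [u] keeps it positive
   definite. *)
pose c := (s - t1) / u; have c_gt0 : 0 < c by rewrite divr_gt0 // subr_gt0.
have cst j : c * s < 1 + c * t j.
  have -> : c * s = c * (s - t j) + c * t j by ring.
  rewrite ltrD2r /c mulrAC ltr_pdivrMr // mul1r.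
  apply: lt_le_trans u_ge; rewrite mulrC ltr_pM2r ?subr_gt0 //.
  by rewrite ltrBlDr ltrDl.
have s_gt0 : 0 < s by apply: lt_trans s_gt.
have d_gt0 j : 0 < 1 + c * t j by apply: addr_gt0 => //; apply: mulr_gt0.
exists (fun j => 1 + c * t j), b, (- c); split=> // [|j|].
- have -> : 1 + - c * (\sum_j b j ^+ 2 / (1 + c * t j)) =
      \sum_j t j * (s^-1 - c / (1 + c * t j)).
    under [RHS]eq_bigr do rewrite mulrBr; rewrite sumrB -mulr_suml -/s divff ?gt_eqF //.
    rewrite mulNr mulr_sumr; congr (_ - _); apply: eq_bigr => j _.
    by rewrite -/(t j); ring.
  have pos j : 0 < t j * (s^-1 - c / (1 + c * t j)).
    by apply: mulr_gt0 => //; rewrite subr_gt0 ltr_pdivrMr // mulrC ltr_pdivlMr.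
  rewrite (bigD1 j0) //= ltr_wpDr // sumr_ge0 // => j _; exact: ltW.
- by rewrite -/(t j); ring.
have -> : \sum_j (1 + c * t j) * a (Some j) ^+ 2 = s + c * \sum_j t j ^+ 2.
  by rewrite mulr_sumr /s -big_split; apply: eq_bigr => j _; rewrite /= -/(b j) -/(t j); ring.
have -> : \sum_j b j * a (Some j) = s by apply: eq_bigr => j _; rewrite /t expr2.
have : c * u = s - t1 by rewrite divfK // gt_eqF.
have alg (X c' s' t' : rat) : c' * (s' ^+ 2 - X) = s' - t' -> s' + c' * X + - c' * s' ^+ 2 = t'.
  by move=> E; lra.
exact: alg.
Qed.

(** With coordinate [i] equal to 1, every other coordinate is given the absolute value [|a i|]
    divided by the sum of the other [|a j|], with signs that balance the relation. *)
Lemma polygon_strict (l : option 'I_m -> V -> rat) :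
    (forall j y, l (Some j) y = y 0 j) ->
    (forall y, l None y = - (\sum_j a (Some j) * y 0 j) / a None) ->
  exists2 lam, 0 <= lam < 1 & forall i, exists2 p, l i p = 1 &
    forall j, j != i -> `|l j p| <= lam.
Proof.
move=> lS lN; pose b j := a (Some j); pose S := \sum_j `|b j|.
have a0_gt0 : 0 < `|a None| by rewrite normr_gt0.
have S_gt0 : 0 < S by apply: lt_trans a_lt.
have one i : exists lam, 0 <= lam < 1 /\ exists2 p, l i p = 1 &
    forall j, j != i -> `|l j p| <= lam.
  case: i => [j0|]; last first.
    exists (`|a None| / S); split.
      by apply/andP; split; [rewrite divr_ge0 // ltW | rewrite ltr_pdivrMr // mul1r].
    pose x := a None / S.
    exists (\row_j (- (Num.sg (b j) * x))) => [|[j|] //= _].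
      rewrite lN -sumrN (eq_bigr (fun j => `|b j| * x)) => [|j _].
        by rewrite -mulr_suml -/S /x; field; rewrite a_neq0 gt_eqF.
      by rewrite mxE -/(b j) [ `|b j| ]normrEsg; ring.
    rewrite lS mxE normrN normrM normr_sg a_neq0 mul1r /x normrM normfV.
    by rewrite (gtr0_norm S_gt0).
  pose T := `|a None| + \sum_(k | k != j0) `|b k|.
  have lt_T : `|b j0| < T.
    have := a_max j0; have := a_lt; rewrite (bigD1 j0) //= -/(b j0) /T.
    by move: (\sum_(_ | _) _) `|b j0| `|a None| => X y z; lra.
  have T_gt0 : 0 < T by apply: le_lt_trans lt_T.
  exists (`|b j0| / T); split.
    by apply/andP; split; [rewrite divr_ge0 // ltW | rewrite ltr_pdivrMr // mul1r].
  pose x := b j0 / T.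
  exists (\row_j (if j == j0 then 1 else - (Num.sg (b j) * x))) => [|[j|] ji].
  - by rewrite lS mxE eqxx.
  - have /negPf jj0 : j != j0 by apply: contra_neq ji => ->.
    rewrite lS mxE jj0 normrN normrM normr_sg a_neq0 mul1r /x normrM normfV.
    by rewrite (gtr0_norm T_gt0).
  rewrite lN (bigD1 j0) //= mxE eqxx mulr1.
  rewrite (eq_bigr (fun j => - (`|b j| * x))) => [|j /negPf jj0]; last first.
    by rewrite mxE jj0 -/(b j) [ `|b j| ]normrEsg; ring.
  rewrite sumrN -mulr_suml -/(b j0).
  have -> : \sum_(j | j != j0) `|b j| = T - `|a None| by rewrite /T; ring.
  have -> : b j0 - (T - `|a None|) * x = `|a None| * x by rewrite /x; field; rewrite gt_eqF.
  rewrite normrM normrN normrM normfV normr_id /x normrM normfV (gtr0_norm T_gt0).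
  by rewrite mulrAC divff ?gt_eqF // mul1r.
have [lam lamP] := fin_all_exists one.
exists (\big[Num.max/0]_i lam i) => [|i].
  apply/andP; split; first by apply: bigmax_ge_id.
  by apply: bigmax_lt => // i _; have [/andP[]] := lamP i.
have [_ [p lp p_le]] := lamP i; exists p => // j ji.
by apply: le_trans (p_le j ji) _; apply: le_bigmax.
Qed.

Theorem polygon_permuted :
    (forall i, exists z : option 'I_m -> rat,
      [/\ forall j, z j \is a Num.int, z i = 1 & \sum_j a j * z j = 0]) ->
  permuted_relation a.
Proof.
move=> onto; have [d [v [c [d_gt0 cQ_gt0 dcv dca]]]] := polygon_form.
pose xi (i : option 'I_m) (j : 'I_m) : rat :=
  if i is Some k then (j == k)%:R else - (a (Some j) / a None).
pose B := rank_one_form d v c; pose w i := rank_one_dual d v c (xi i).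
have lS k y : B (w (Some k)) y = y 0 k.
  rewrite /B rank_one_dualE // (bigD1 k) //= eqxx mul1r big1 ?addr0 // => j /negPf->.
  by rewrite mul0r.
have lN y : B (w None) y = - (\sum_j a (Some j) * y 0 j) / a None.
  rewrite /B rank_one_dualE // -sumrN mulr_suml; apply: eq_bigr => j _ /=.
  by rewrite mulNr mulrAC mulNr.
have Bw i : B (w i) (w i) = 1.
  case: i => [k|].
    rewrite lS mxE /= eqxx mulr1 (bigD1 k) //= eqxx mulr1 big1 ?addr0 => [|j /negPf->].
      by rewrite -mulrA -expr2.
    by rewrite mulr0.
  have a0 := a_neq0 None.
  pose A := \sum_j v j * a (Some j).
  have S'E : \sum_k v k * xi None k = - (A / a None).
    by rewrite /A mulr_suml -sumrN; apply: eq_bigr => k _ /=; rewrite mulrN mulrA.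
  have E : \sum_j a (Some j) * w None 0 j = - (a None ^+ 2 / a None).
    rewrite -dca mulrDl opprD [c * _]mulrC mulr_suml -sumrN.
    have -> : A ^+ 2 * c / a None = \sum_j a (Some j) * v j * c * A / a None.
      by rewrite expr2 {1}/A !mulr_suml; apply: eq_bigr => j _; ring.
    rewrite -sumrN -big_split /=; apply: eq_bigr => j _.
    by rewrite mxE S'E /=; ring.
  by rewrite lN E; field.
have BD := @rank_one_formDl m d v c.
have BZ := @rank_one_formZl m d v c.
have BC := @rank_one_formC m d v c.
have Bge0 := rank_one_form_ge0 d_gt0 cQ_gt0.
have coordP (j : 'I_m) : exists i, forall y : V, y 0 j = B (w i) y by exists (Some j) => y; rewrite lS.
have sum0 y : \sum_i a i * B (w i) y = 0.
  rewrite big_option lN mulrC divfK // addrC; apply/eqP; rewrite subr_eq0; apply/eqP.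
  by apply: eq_bigr => j _; rewrite lS.
have latticeE y z : (forall i, z i \is a Num.int) -> (forall i, B (w i) y = z i) -> y \in lattice B w.
  by move=> z_int yz; apply/latticeP => i; rewrite yz.
have lattice_onto i : exists2 h, h \in lattice B w & B (w i) h = 1.
  have [z [z_int zi az]] := onto i; pose y : V := \row_j z (Some j).
  have yz j : B (w j) y = z j.
    case: j => [j|]; first by rewrite lS mxE.
    move: az; rewrite big_option lN => /eqP; rewrite addr_eq0 => /eqP az.
    apply: (mulIf (a_neq0 None)); rewrite divfK // mulrC az; congr (- _).
    by apply: eq_bigr => j _; rewrite mxE.
  by exists y; [apply: latticeE yz | rewrite yz].
have [lam /andP[lam0 lam1] strict] := @polygon_strict (fun i => B (w i)) lS lN.
have [om [_ om_ge0 om_pos om_bal]] :=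
  balanced_exists BD BZ BC Bge0 Bw coordP lattice_onto lam0 lam1 strict None.
exact: balanced_permuted sum0 om_ge0 om_pos om_bal.
Qed.

End Polygon.

(** * Number fields with symmetric Galois group *)

Section PrimeDegree.
Local Open Scope group_scope.

Variables (p : nat) (H : {group 'S_p}).
Hypothesis p_prime : prime p.
Hypothesis H_trans : forall i j : 'I_p, exists2 s, s \in H & s i = j.

(** Being exchanged by a transposition of [H] is an equivalence relation invariant under [H]. By
    transitivity its classes have equal size, which divides [p] and exceeds 1, so [H] contains all
    transpositions. *)
Lemma prime_transitive_tperm_full (x y : 'I_p) :
  x != y -> tperm x y \in H -> H = [set: 'S_p] :> {set 'S_p}.
Proof.
move=> xy Hxy; pose e (i j : 'I_p) := tperm i j \in H.
have e_refl i : e i i by rewrite /e tperm1 group1.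
have e_sym i j : e i j = e j i by rewrite /e tpermC.
have eJ i j s : s \in H -> e (s i) (s j) = e i j.
  by move=> Hs; rewrite /e -tpermJ memJ_norm // (subsetP (normG H)).
have e_trans : {in [set: 'I_p] & &, equivalence_rel e}.
  move=> i j k _ _ _; split=> // e_ij.
  have [->//|ij] := eqVneq i j.
  have step a b c : e a b -> e b c -> e a c.
    move=> e_ab e_bc; have [->//|ac] := eqVneq a c; have [->//|ab] := eqVneq a b.
    have [ba ca] : b != a /\ c != a by rewrite eq_sym ab eq_sym ac.
    by have := eJ a b _ e_bc; rewrite e_ab tpermL tpermD // => ->.
  by apply/idP/idP; apply: step; rewrite // e_sym.
have part := equivalence_partitionP e_trans.
pose C i := [set j in [set: 'I_p] | e i j].
have cardC i : #|C i| = #|C x|.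
  have [s Hs <-] := H_trans x i; rewrite -(card_imset (C x) (@perm_inj _ s)).
  apply: eq_card => j; rewrite !inE /=; apply/idP/imsetP => [e_j|[k]].
    by exists (s^-1 j); rewrite ?permKV // !inE -(eJ _ _ s) ?permKV.
  by rewrite !inE => e_k ->; rewrite eJ.
have := card_uniform_partition (n := #|C x|) _ part; rewrite cardsT card_ord => cardE.
have {cardE} dvd_C : (#|C x| %| p)%N.
  apply/dvdnP; exists #|equivalence_partition e [set: 'I_p]|; apply: cardE.
  by move=> _ /imsetP[i _ ->]; apply: cardC.
have C_gt1 : (1 < #|C x|)%N.
  by rewrite (cardsD1 x) (cardsD1 y) !inE /e tperm1 group1 eq_sym xy Hxy.
have CT : C x = [set: 'I_p].
  apply/eqP; rewrite eqEcard subsetT cardsT card_ord /=.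
  by have /primeP[_ /(_ _ dvd_C)/orP[/eqP C1|/eqP->//]] := p_prime; rewrite C1 in C_gt1.
apply/eqP; rewrite eqEsubset subsetT -(gen_tperm x) gen_subG.
apply/subsetP => _ /imsetP[j _ ->]; have : j \in C x by rewrite CT inE.
by rewrite !inE.
Qed.

End PrimeDegree.

Section ConjugationClosed.

Variable rs : seq algC.
Hypothesis rs_uniq : uniq rs.
Hypothesis rs_conj : forall z, z \in rs -> z^* \in rs.

(** Conjugate pairs contribute squared absolute values. *)
Lemma prod_nonreal_ge0 (x : algC) : x \is Num.real ->
  0 <= \prod_(z <- rs | z \isn't Num.real) (x - z).
Proof.
move=> xR.
have perm_conj : perm_eq [seq z^* | z <- rs] rs.
  apply: uniq_perm => [||z]; rewrite ?(map_inj_uniq (inv_inj conjCK)) //.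
  apply/mapP/idP => [[t /rs_conj t_rs ->] //|z_rs].
  by exists z^*; rewrite ?conjCK ?rs_conj.
have split_prod : \prod_(z <- rs | z \isn't Num.real) (x - z) =
    \prod_(z <- rs | 0 < 'Im z) (x - z) * \prod_(z <- rs | 'Im z < 0) (x - z).
  rewrite (bigID (fun z => 0 < 'Im z)) /=; congr (_ * _); apply: eq_bigl => z.
    by rewrite (sameP (Creal_ImP z) eqP) andb_idl // => /gt_eqF->.
  by rewrite (sameP (Creal_ImP z) eqP); case: real_ltgt0P (Creal_Im z).
have conj_prod : \prod_(z <- rs | 'Im z < 0) (x - z) = (\prod_(z <- rs | 0 < 'Im z) (x - z))^*.
  rewrite -(perm_big _ perm_conj) big_map rmorph_prod /=; apply: eq_big => z.
    by rewrite Im_conj oppr_lt0.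
  by move=> _; rewrite rmorphB /= (CrealP xR).
by rewrite split_prod conj_prod -normCK exprn_ge0.
Qed.

(** Intermediate values by factorization: a real root outside the interval contributes a nonnegative
    [(a - z) * (b - z)], and so do the nonreal roots together. *)
Lemma real_root_between (a b : algC) : a \is Num.real -> b \is Num.real ->
    (\prod_(z <- rs) (a - z)) * (\prod_(z <- rs) (b - z)) < 0 ->
  exists2 z, z \in rs & (a < z < b) || (b < z < a).
Proof.
move=> aR bR prod_lt0.
have [/hasP[z z_rs z_ab]|/hasPn none] := boolP (has (fun z => (a < z < b) || (b < z < a)) rs).
  by exists z.
suff : 0 <= (\prod_(z <- rs) (a - z)) * (\prod_(z <- rs) (b - z)).
  by move=> prod_ge0; rewrite (le_gtF prod_ge0) in prod_lt0.
rewrite (bigID (fun z => z \is Num.real)) /= [X in _ * X](bigID (fun z => z \is Num.real)) /=.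
rewrite mulrACA; apply: mulr_ge0; last by apply: mulr_ge0; apply: prod_nonreal_ge0.
rewrite -big_split /= big_seq_cond prodr_ge0 // => z /andP[z_rs zR].
have := none z z_rs; rewrite negb_or !negb_and -!real_leNgt //.
case/andP=> /orP[za|bz] /orP[zb|az].
- by rewrite mulr_ge0 ?subr_ge0.
- by rewrite (le_anti (introT andP (conj za az))) subrr mul0r.
- by rewrite (le_anti (introT andP (conj zb bz))) subrr mulr0.
- by rewrite mulr_le0 ?subr_le0.
Qed.

End ConjugationClosed.

Lemma irreducible_rat_separable (f : {poly rat}) : irreducible_poly f -> separable_poly f.
Proof.
move=> [f_gt1 f_irr]; rewrite separable_poly.unlock; apply/eqP; set g := gcdp f f^`().
have f_neq0 : f != 0 by rewrite -size_poly_gt0 ltnW.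
have f'_neq0 : f^`() != 0.
  apply: contraTneq f_gt1 => f'0; rewrite -leqNgt; case sz: (size f) => [|[|k]] //.
  have := congr1 (fun h : {poly rat} => h`_k) f'0; rewrite coef0 coef_deriv => /eqP.
  by rewrite mulrn_eq0 /= -[k.+1]/(k.+2.-1) -sz lead_coef_eq0 (negPf f_neq0).
have [//|g1] := eqVneq (size g) 1%N.
have fg : g %= f by apply: f_irr => //; apply: dvdp_gcdl.
have : (size f <= size f^`())%N.
  by rewrite -(eqp_size fg); apply: dvdp_leq => //; apply: dvdp_gcdr.
by rewrite leqNgt lt_size_deriv.
Qed.

(** * An irreducible polynomial with exactly two nonreal roots *)

Section EisensteinPolynomial.

Variable r : nat.
Hypothesis r_gt0 : (0 < r)%N.

Definition even_nodes : seq int := [seq (2 * i)%:Z | i <- iota 0 r].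

(* [node_poly - 2] is Eisenstein at 2 and changes sign between consecutive odd
   integers, which leaves at most two nonreal roots.  If all roots were real, its
   value at the square roots of -4 would have absolute value larger than 2. *)
Definition node_poly : {poly int} := ('X^2 + 4%:P) * \prod_(k <- even_nodes) ('X - k%:P).

Definition eisenstein_poly : {poly int} := node_poly - 2%:P.

Lemma node_poly_monic : node_poly \is monic.
Proof. by rewrite monicMl ?monic_prod_XsubC // monicXnaddC. Qed.

Lemma size_node_poly : size node_poly = r.+3.
Proof.
rewrite size_monicM ?monicXnaddC // ?monic_neq0 ?monic_prod_XsubC //.
by rewrite size_XnaddC // size_prod_XsubC size_map size_iota addnS.
Qed.

Lemma size_eisenstein_poly : size eisenstein_poly = r.+3.
Proof. by rewrite size_polyDl size_node_poly // size_polyN (leq_ltn_trans (size_polyC_leq1 _)). Qed.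

Lemma eisenstein_poly_monic : eisenstein_poly \is monic.
Proof.
rewrite monicE lead_coefDl ?(monicP node_poly_monic) //.
by rewrite size_node_poly size_polyN (leq_ltn_trans (size_polyC_leq1 _)).
Qed.

Lemma eisenstein_poly_irreducible : irreducible_poly (map_poly (intr : int -> rat) eisenstein_poly).
Proof.
apply/irreducible_rat_int; apply: (@eisenstein_crit 2) => //.
- by rewrite size_eisenstein_poly.
- by rewrite (monicP eisenstein_poly_monic).
(* Since 0 is a node, the constant coefficient is [-2], not divisible by 4. *)
- have node0 : node_poly.[0] = 0.
    apply/rootP; rewrite rootM root_prod_XsubC; apply/orP; right.
    by apply/mapP; exists 0%N; rewrite ?mem_iota.
  by rewrite -horner_coef0 /eisenstein_poly hornerD hornerN hornerC node0.
move=> i; rewrite size_eisenstein_poly /= => lt_i.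
have F2 := pchar_Fp (isT : prime 2).
rewrite (dvdz_pcharf F2) -coef_map /= rmorphB /= rmorphM /= rmorphD /= rmorph_prod /=.
rewrite !map_polyXn !map_polyC /=.
have -> : (4%:~R : 'F_2) = 0 by apply/eqP.
have -> : (2%:~R : 'F_2) = 0 by apply/eqP.
rewrite (eq_big_seq (fun=> 'X)) => [|k /mapP[j _ ->]]; last first.
  rewrite rmorphB /= map_polyX map_polyC /= PoszM intrM.
  have -> : (2%:~R : 'F_2) = 0 by apply/eqP.
  by rewrite mul0r subr0.
rewrite subr0 addr0 big_const_seq count_predT size_map size_iota -Monoid.iteropE -exprD.
by rewrite coefXn ltn_eqF.
Qed.

Lemma eisenstein_polyE (R : comNzRingType) (x : R) :
  (map_poly (intr : int -> R) eisenstein_poly).[x] =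
  (x ^+ 2 + 4) * \prod_(i <- iota 0 r) (x - (2 * i)%:R) - 2.
Proof.
rewrite rmorphB /= rmorphM /= rmorphD /= rmorph_prod /= map_polyXn !map_polyC /=.
rewrite !hornerE horner_prod big_map; congr (_ * _ - _).
by apply: eq_bigr => i _; rewrite rmorphB /= map_polyX map_polyC /= !hornerE.
Qed.

(** At an odd integer each linear factor has absolute value at least 1 and [x^2 + 4 > 2], so
    subtracting 2 does not change the sign of [node_poly]. *)
Lemma eisenstein_poly_sign j : (j <= r)%N ->
  0 < (-1) ^+ (r - j) * eisenstein_poly.[(2 * j)%:Z - 1].
Proof.
move=> le_jr; set x := (2 * j)%:Z - 1.
have -> : eisenstein_poly.[x] = (x ^+ 2 + 4) * \prod_(i <- iota 0 r) (x - (2 * i)%:R) - 2.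
  by rewrite -eisenstein_polyE map_poly_id // => k _; apply: intz.
have prod_ge1 s (F : nat -> int) : (forall i, i \in s -> 1 <= F i) -> 1 <= \prod_(i <- s) F i.
  elim: s => [|i s IHs] Fs; first by rewrite big_nil.
  rewrite big_cons; have := Fs i (mem_head _ _).
  have : 1 <= \prod_(i <- s) F i by apply: IHs => k ks; apply: Fs; rewrite inE ks orbT.
  by move: (\prod_(_ <- _) _) (F i) => P f; nia.
have : 1 <= (-1) ^+ (r - j) * \prod_(i <- iota 0 r) (x - (2 * i)%:R).
  rewrite -{2}(subnKC le_jr) iotaD add0n big_cat /= mulrCA.
  have -> : (-1) ^+ (r - j) * \prod_(i <- iota j (r - j)) (x - (2 * i)%:R) =
      \prod_(i <- iota j (r - j)) ((2 * i)%:R - x).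
    rewrite -[in (-1) ^+ _](size_iota j (r - j)); elim: (iota _ _) => [|i s IHs].
      by rewrite !big_nil mulr1.
    by rewrite !big_cons exprS -IHs /=; ring.
  have p1 : 1 <= \prod_(i <- iota 0 j) (x - (2 * i)%:R).
    by apply: prod_ge1 => i; rewrite mem_iota /x pmulrn; lia.
  have p2 : 1 <= \prod_(i <- iota j (r - j)) ((2 * i)%:R - x).
    by apply: prod_ge1 => i; rewrite mem_iota /x pmulrn; lia.
  by move: p1 p2; move: (\prod_(_ <- _) _) (\prod_(_ <- _) _) => P P'; nia.
move: (\prod_(_ <- _) _) => P; rewrite -signr_odd; case: odd; rewrite ?expr1 ?expr0; nia.
Qed.

Local Notation fC := (map_poly ratr (map_poly (intr : int -> rat) eisenstein_poly) : {poly algC}).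

Lemma eisenstein_roots : exists rs : seq algC,
  [/\ uniq rs, size rs = r.+2, fC = \prod_(z <- rs) ('X - z%:P) &
   exists z, [/\ z \in rs, z^* \in rs, z \isn't Num.real &
     forall t, t \in rs -> t \isn't Num.real -> t = z \/ t = z^*]].
Proof.
have fCE : fC = map_poly intr eisenstein_poly.
  by rewrite -map_poly_comp; apply: eq_map_poly => k /=; rewrite ratr_int.
have [rs] := closed_field_poly_normal fC.
have -> : lead_coef fC = 1.
  by rewrite fCE; apply/monicP/monic_map/eisenstein_poly_monic.
rewrite scale1r => fC_rs; exists rs.
have rs_uniq : uniq rs.
  rewrite -separable_prod_XsubC -fC_rs separable_map.
  exact/irreducible_rat_separable/eisenstein_poly_irreducible.
have size_rs : size rs = r.+2.
  apply: succn_inj; rewrite -(size_prod_XsubC rs id) -fC_rs.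
  by rewrite fCE size_map_poly_id0 ?size_eisenstein_poly // (monicP eisenstein_poly_monic) oner_neq0.
have rootE z : (z \in rs) = root fC z by rewrite fC_rs root_prod_XsubC.
have rs_conj z : z \in rs -> z^* \in rs.
  rewrite !rootE fCE => /rootP fz0; apply/rootP.
  have -> : map_poly intr eisenstein_poly = map_poly Num.conj (map_poly intr eisenstein_poly) :> {poly algC}.
    by rewrite -map_poly_comp; apply: eq_map_poly => k /=; rewrite rmorph_int.
  by rewrite horner_map fz0 rmorph0.
have evalE x : \prod_(z <- rs) (x - z) = fC.[x].
  by rewrite fC_rs horner_prod; apply: eq_bigr => z _; rewrite !hornerE.
have [rho rhoP] : exists rho : 'I_r -> algC, forall i, rho i \in rs /\
    ((2 * i)%:Z - 1)%:~R < rho i < ((2 * i.+1)%:Z - 1)%:~R.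
  suff ex (i : 'I_r) : exists z, z \in rs /\ ((2 * i)%:Z - 1)%:~R < z < ((2 * i.+1)%:Z - 1)%:~R.
    exact: fin_all_exists ex.
  have [||//|z z_rs z_ab] := @real_root_between rs rs_uniq rs_conj
      ((2 * i)%:Z - 1)%:~R ((2 * i.+1)%:Z - 1)%:~R.
  - exact: realz.
  - exact: realz.
  - rewrite !evalE fCE !horner_map -intrM ltrz0.
    have := eisenstein_poly_sign (ltnW (ltn_ord i)); have := eisenstein_poly_sign (ltn_ord i).
    rewrite -[(r - i)%N](subnSK (ltn_ord i)) exprS.
    move: (_.[_]) (_.[_]) => P P'; rewrite -signr_odd; case: odd; rewrite ?expr1 ?expr0; nia.
  exists z; split=> //; case/orP: z_ab => // /andP[lt1 lt2].
  by have := lt_trans lt1 lt2; rewrite ltr_int; lia.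
have rho_real i : rho i \is Num.real.
  have [_ /andP[lt_r _]] := rhoP i.
  by rewrite (ger_real (ltW lt_r)) realz.
have rho_lt (i j : 'I_r) : (i < j)%N -> rho i < rho j.
  move=> lt_ij; have [_ /andP[_ lt1]] := rhoP i; have [_ /andP[lt2 _]] := rhoP j.
  by apply: lt_trans lt1 (le_lt_trans _ lt2); rewrite ler_int; lia.
have rho_inj : injective rho.
  move=> i j eq_ij; apply: val_inj => /=; case: (ltngtP i j) => // lt_ij.
    by have := rho_lt _ _ lt_ij; rewrite eq_ij ltxx.
  by have := rho_lt _ _ lt_ij; rewrite eq_ij ltxx.
have [z z_rs z_nreal] : exists2 z, z \in rs & z \isn't Num.real.
  apply/hasP; apply: contraT => /hasPn all_real.
  have : `|fC.[2 * 'i]| = 2.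
    rewrite fCE eisenstein_polyE exprMn sqrCi.
    have -> : 2 ^+ 2 * -1 + 4 = 0 :> algC by ring.
    by rewrite mul0r sub0r normrN normr_nat.
  rewrite -evalE normr_prod => prod2.
  have : 2 ^+ r.+2 <= \prod_(z <- rs) `|2 * 'i - z| :> algC.
    rewrite (_ : 2 ^+ r.+2 = \prod_(z <- rs) 2); last first.
      by rewrite big_const_seq count_predT size_rs iter_mulr_1.
    rewrite big_seq [leRHS]big_seq ler_prod // => z z_rs; rewrite ler0n /=.
    have zR := negbNE (all_real z z_rs).
    rewrite -(@ler_pXn2r _ 2) ?nnegrE ?normr_ge0 ?ler0n // normCK.
    rewrite rmorphB rmorphM /= conjCi conjC_nat (CrealP zR).
    have -> : (2 * 'i - z) * (2 * - 'i - z) = z ^+ 2 - 2 ^+ 2 * 'i ^+ 2 :> algC by ring.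
    by rewrite sqrCi mulrN1 opprK lerDr real_exprn_even_ge0.
  rewrite prod2 -natrX ler_nat !expnS; have := expn_gt0 2 r; lia.
split=> //; exists z; split=> // [|t t_rs t_nreal]; first exact: rs_conj.
have [->|tz] := eqVneq t z; first by left.
have [->|tz'] := eqVneq t z^*; first by right.
have zz' : z != z^* by rewrite eq_sym; apply: contra z_nreal => /eqP/CrealP.
(* A third nonreal root would give [r + 3] distinct roots in degree [r + 2]. *)
pose s := [:: t, z, z^* & [seq rho i | i : 'I_r]].
have s_rs : {subset s <= rs}.
  move=> u; rewrite !inE => /or4P[/eqP->|/eqP->|/eqP->|/mapP[i _ ->]] //; first exact: rs_conj.
  by have [] := rhoP i.
have notR u : u \isn't Num.real -> u \notin [seq rho i | i : 'I_r].
  by apply: contra => /mapP[i _ ->].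
have s_uniq : uniq s.
  have z'_nreal : z^* \isn't Num.real.
    by apply: contra zz' => /CrealP; rewrite conjCK => {1}->.
  rewrite /= !inE !negb_or tz tz' zz' (notR t) // (notR z) // (notR z^*) //=.
  by rewrite map_inj_uniq ?enum_uniq.
by have := uniq_leq_size s_uniq s_rs; rewrite /= size_map -cardE card_ord size_rs ltnn.
Qed.

End EisensteinPolynomial.

(** * Fields in which every permutation of the roots is realized *)

Definition realizes (L : splittingFieldType rat) N (al : 'I_N -> L) (s : 'S_N) :=
  exists2 g : gal_of {:L}, g \in 'Gal({:L} / 1)%g & forall k, g (al k) = al (s k).

Lemma irreducible_gal_trans (L : splittingFieldType rat) (f : {poly rat}) (a b : L) :
    irreducible_poly f -> root (map_poly (in_alg L) f) a -> root (map_poly (in_alg L) f) b ->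
  exists2 g : gal_of {:L}, g \in 'Gal({:L} / 1)%g & g a = b.
Proof.
move=> [f_gt1 f_irr] fa fb; apply: normalField_root_minPoly (memvf a) _; rewrite ?sub1v ?normalFieldf //.
have f1 : map_poly (in_alg L) f \is a polyOver 1%AS.
  by apply/polyOverP=> i; rewrite coef_map memvZ ?memv_line.
have [q Dq] := polyOver1P (minPolyOver 1%AS a).
have dvd_q : minPoly 1 a %| map_poly (in_alg L) f by apply: minPoly_dvdp.
have q_sz : size q != 1%N.
  by rewrite -(size_map_poly (in_alg L)) -Dq size_minPoly eqSS -lt0n adjoin_degreeE divn_gt0 ?adim_gt0 ?dimvS ?subv_adjoin.
have : q %= f by apply: f_irr => //; rewrite -(dvdp_map (in_alg L)) -Dq.
by rewrite -(eqp_map (in_alg L)) -Dq => /eqp_root->.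
Qed.

Lemma gal_perm (L : splittingFieldType rat) N (al : 'I_N -> L) (f : {poly rat}) (g : gal_of {:L}) :
    injective al -> (forall x, root (map_poly (in_alg L) f) x -> exists k, x = al k) ->
    (forall k, root (map_poly (in_alg L) f) (al k)) ->
  exists s : 'S_N, forall k, g (al k) = al (s k).
Proof.
move=> al_inj f_al al_f.
have ex k : exists j, g (al k) = al j.
  apply: f_al; have /rootP fk := al_f k; apply/rootP.
  have -> : map_poly (in_alg L) f = map_poly g (map_poly (in_alg L) f).
    by rewrite -map_poly_comp; apply: eq_map_poly => c /=; rewrite rmorph_alg.
  by rewrite horner_map fk rmorph0.
have [s sE] := fin_all_exists ex.
have s_inj : injective s.
  move=> i j eq_ij; have : g (al i) = g (al j) by rewrite !sE eq_ij.
  by move/(fmorph_inj g)/al_inj.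
by exists (perm s_inj) => k; rewrite permE.
Qed.

Lemma symmetric_extension (n : nat) : exists N, (n < N)%N /\
  exists L : splittingFieldType rat, galois 1 {:L} /\
  exists al : 'I_N -> L, injective al /\ forall s, realizes al s.
Proof.
have [p lt_p p_prime] := prime_above n.+2.
have lt_np : (n < p)%N by lia.
have [r r_gt0 pE] : exists2 r, (0 < r)%N & p = r.+2 by exists p.-2; lia.
pose f := map_poly (intr : int -> rat) (eisenstein_poly r).
have f_irr : irreducible_poly f by apply: eisenstein_poly_irreducible.
have [rs [rs_uniq size_rs f_rs [z [z_rs z'_rs z_nreal z_only]]]] := eisenstein_roots r_gt0.
have [Qs [QsC [s1 s1E s1_gen]]] := num_field_exists rs.
pose P := map_poly (in_alg Qs) f.
have P1 : P \is a polyOver 1%VS.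
  by apply/polyOverP=> i; rewrite coef_map memvZ ?memv_line.
have P_s1 : P = \prod_(x <- s1) ('X - x%:P).
  apply: (map_poly_inj QsC); rewrite rmorph_prod /= -map_poly_comp.
  rewrite (eq_map_poly (g := ratr)) => [|c /=]; last by rewrite alg_num_field fmorph_rat.
  by rewrite f_rs -s1E big_map; apply: eq_bigr => x _; rewrite map_polyXsubC.
have split_P : splittingFieldFor 1 P fullv by exists s1; rewrite ?P_s1 ?eqpxx.
pose LMixin := FieldExt_isSplittingField.Build rat Qs (ex_intro2 _ _ P P1 split_P).
pose L : splittingFieldType rat := HB.pack Qs LMixin.
exists p; split=> //.
exists L; split.
  apply/splitting_galoisField; exists P; split=> //.
  by rewrite separable_map; apply: irreducible_rat_separable.
have size_s1 : size s1 = p by rewrite -(size_map QsC) s1E size_rs pE.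
have s1_uniq : uniq s1 by rewrite -(map_inj_uniq (fmorph_inj QsC)) s1E.
pose al (k : 'I_p) : L := s1`_k.
have al_s1 k : al k \in s1 by rewrite mem_nth // size_s1.
have al_inj : injective al.
  move=> i j /eqP; rewrite nth_uniq ?size_s1 // => /eqP; exact: val_inj.
have s1_al x : x \in s1 -> exists k, x = al k.
  move=> x_s1; have lt_x : (index x s1 < p)%N by rewrite -size_s1 index_mem.
  by exists (Ordinal lt_x); rewrite /al /= nth_index.
have root_s1 (x : L) : root (map_poly (in_alg L) f) x = (x \in s1).
  by rewrite -root_prod_XsubC -P_s1.
exists al; split=> //.
pose H := [set s : 'S_p | [exists g in 'Gal({:L} / 1)%g, [forall k, g (al k) == al (s k)]]].
have HP s : reflect (realizes al s) (s \in H).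
  rewrite inE; apply: (iffP exists_inP) => [[g gG /forallP gs]|[g gG gs]].
    by exists g => // k; apply/eqP.
  by exists g => //; apply/forallP => k; rewrite gs.
have H_group : group_set H.
  apply/group_setP; split=> [|s t /HP[g gG gs] /HP[h hG ht]]; apply/HP.
    by exists 1%g => [|k]; rewrite ?group1 // perm1 gal_id.
  by exists (g * h)%g => [|k]; rewrite ?groupM // galM ?memvf // gs ht permM.
have gal_H g : g \in 'Gal({:L} / 1)%g -> exists2 s, s \in H & forall k, g (al k) = al (s k).
  move=> gG; have [||s sE] := @gal_perm L p al f g al_inj.
  - by move=> x; rewrite root_s1 => /s1_al.
  - by move=> k; rewrite root_s1 al_s1.
  by exists s => //; apply/HP; exists g.
have H_trans (i j : 'I_p) : exists2 s, s \in Group H_group & s i = j.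
  have [||g gG gij] := @irreducible_gal_trans L f (al i) (al j) f_irr; rewrite ?root_s1 //.
  by have [s sH sE] := gal_H g gG; exists s => //; apply: al_inj; rewrite -sE.
have [zz /[dup] zz_s1 /s1_al[x zx] zE] : exists2 y, y \in s1 & z = QsC y.
  by apply/mapP; rewrite s1E.
have [zz' /[dup] zz'_s1 /s1_al[y zy] z'E] : exists2 y, y \in s1 & z^* = QsC y.
  by apply/mapP; rewrite s1E.
have z_neq : z^* != z by apply: contra z_nreal => /eqP/CrealP.
have xy : x != y.
  by apply: contra z_neq => /eqP xy; rewrite z'E zE zx zy xy.
(* Complex conjugation restricts to the normal field [L]; it fixes the real roots and exchanges the
   two nonreal ones. *)
have [nu nuE] := restrict_aut_to_normal_num_field (Qn := L) QsC Num.conj.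
have hom_nu : kHom 1 {:L} (linfun nu).
  by apply/kHom_lrmorphism; split=> [a b|]; rewrite !lfunE /= ?rmorphM ?rmorph1.
have [||g gG gE] := kHom_to_gal (K := 1%AS) (M := {:L}%AS) (E := {:L}%AS) _ _ hom_nu.
- by rewrite sub1v subvv.
- exact: normalFieldf.
have [t tH tE] := gal_H g gG.
have gC k : QsC (al (t k)) = (QsC (al k))^*.
  by rewrite -tE -gE ?memvf // lfunE /= nuE.
have t_tperm : t = tperm x y.
  apply/permP => k; apply/al_inj/(fmorph_inj QsC); rewrite gC.
  case: tpermP => [->|->|kx ky]; first by rewrite -zx -zE -zy -z'E.
    by rewrite -zx -zE -zy -z'E conjCK.
  apply/CrealP; apply: contraT => k_nreal.
  have k_rs : QsC (al k) \in rs by rewrite -s1E map_f.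
  have [kz|kz] := z_only _ k_rs k_nreal.
    by case: kx; apply/al_inj/(fmorph_inj QsC); rewrite kz zE zx.
  by case: ky; apply/al_inj/(fmorph_inj QsC); rewrite kz z'E zy.
have t_H : tperm x y \in Group H_group by rewrite -t_tperm.
have HT := prime_transitive_tperm_full p_prime H_trans xy t_H.
by move=> s; apply/HP; have := in_setT s; rewrite -HT.
Qed.

(** * Necessity *)

Lemma padic_val_frac p (m d : int) : m != 0 -> d != 0 ->
  padic_val p (m%:~R / d%:~R) = (logn p `|m|)%:Z - (logn p `|d|)%:Z.
Proof.
move=> m0 d0; set x := m%:~R / d%:~R.
have x0 : x != 0 by rewrite mulf_neq0 ?invr_eq0 ?intr_eq0.
have /eqP : (numq x * d)%:~R = (m * denq x)%:~R :> rat.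
  rewrite !intrM [X in X * _]numqE /x mulrAC divfK ?intr_eq0 //.
rewrite eqr_int => /eqP/(congr1 absz)/(congr1 (logn p)).
rewrite !abszM !lognM ?absz_gt0 ?numq_eq0 ?denq_neq0 // /padic_val; lia.
Qed.

Lemma logn_abszD p (m k : int) : prime p -> m != 0 -> k != 0 -> m + k != 0 ->
  (logn p `|m| <= logn p `|k|)%N -> (logn p `|m| <= logn p `|(m + k)%R|)%N.
Proof.
move=> p_prime m0 k0 mk0 le_mk; rewrite -pfactor_dvdn ?absz_gt0 //.
have : (Posz (p ^ logn p `|m|) %| m + k)%Z.
  by rewrite rpredD // dvdzE /= pfactor_dvdn ?absz_gt0.
by rewrite dvdzE.
Qed.

Section PadicAbs.

Variable p : nat.
Hypothesis p_prime : prime p.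

Let p0 : (p%:R : rat) != 0.
Proof. by rewrite pnatr_eq0 -lt0n prime_gt0. Qed.

Let p_gt1 : 1 < (p%:R : rat).
Proof. by rewrite ltr1n prime_gt1. Qed.

Lemma padic_absE x : x != 0 -> padic_abs p x = p%:R ^ (- padic_val p x).
Proof. by rewrite /padic_abs => /negPf->. Qed.

Lemma padic_abs_ge0 x : 0 <= padic_abs p x.
Proof. by rewrite /padic_abs; case: ifP => // _; rewrite exprz_ge0 ?ler0n. Qed.

Lemma padic_abs_gt0 x : x != 0 -> 0 < padic_abs p x.
Proof. by move=> x0; rewrite padic_absE // exprz_gt0 ?ltr0n ?prime_gt0. Qed.

Lemma padic_absM x y : padic_abs p (x * y) = padic_abs p x * padic_abs p y.
Proof.
have [->|x0] := eqVneq x 0; first by rewrite /padic_abs mul0r eqxx mul0r.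
have [->|y0] := eqVneq y 0; first by rewrite /padic_abs mulr0 eqxx mulr0.
rewrite !padic_absE ?mulf_neq0 // -expfzDr //; congr (_ ^ _).
rewrite -{1}[x]divq_num_den -{1}[y]divq_num_den mulrACA -invfM -!intrM.
rewrite padic_val_frac ?mulf_neq0 ?numq_eq0 ?denq_neq0 //.
rewrite !abszM !lognM ?absz_gt0 ?numq_eq0 ?denq_neq0 // /padic_val; lia.
Qed.

Lemma padic_abs_le x y : x != 0 -> y != 0 ->
  (padic_abs p x <= padic_abs p y) = (padic_val p y <= padic_val p x).
Proof. by move=> x0 y0; rewrite !padic_absE // ler_eXz2l // lerN2. Qed.

Lemma padic_absN x : padic_abs p (- x) = padic_abs p x.
Proof. by rewrite /padic_abs oppr_eq0 /padic_val numqN denqN abszN. Qed.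

Lemma padic_absD x y : padic_abs p (x + y) <= Num.max (padic_abs p x) (padic_abs p y).
Proof.
have [->|x0] := eqVneq x 0; first by rewrite add0r le_max lexx orbT.
have [->|y0] := eqVneq y 0; first by rewrite addr0 le_max lexx.
have [->|xy0] := eqVneq (x + y) 0; first by rewrite {1}/padic_abs eqxx le_max padic_abs_ge0.
rewrite le_max !padic_abs_le //.
pose d := denq x * denq y; pose m := numq x * denq y; pose k := numq y * denq x.
have d0 : d != 0 by rewrite mulf_neq0 ?denq_neq0.
have dQ0 : (d%:~R : rat) != 0 by rewrite intr_eq0.
have xE : x = m%:~R / d%:~R.
  by rewrite /m /d !intrM numqE -[x * _ * _]mulrA mulfK // -intrM.
have yE : y = k%:~R / d%:~R.
  by rewrite /k /d [denq x * _]mulrC !intrM numqE -[y * _ * _]mulrA mulfK // -intrM mulrC.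
have xyE : x + y = (m + k)%:~R / d%:~R by rewrite {1}xE {1}yE -mulrDl intrD.
have m0 : m != 0 by rewrite mulf_neq0 ?denq_neq0 ?numq_eq0.
have k0 : k != 0 by rewrite mulf_neq0 ?denq_neq0 ?numq_eq0.
have mk0 : m + k != 0.
  by apply: contra xy0 => /eqP mk; rewrite xyE mk mul0r.
rewrite xyE xE yE !padic_val_frac // !lerD2r !lez_nat.
have [le_mk|/ltnW le_km] := leqP (logn p `|m|) (logn p `|k|).
  by rewrite logn_abszD.
by rewrite addrC [X in _ || X]logn_abszD ?orbT // addrC.
Qed.

Lemma padic_abs_sum (I : Type) (s : seq I) (P : pred I) (F : I -> rat) :
  padic_abs p (\sum_(i <- s | P i) F i) <= \big[Num.max/0]_(i <- s | P i) padic_abs p (F i).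
Proof.
elim: s => [|i s IHs]; first by rewrite !big_nil /padic_abs eqxx.
rewrite !big_cons; case: (P i) => //.
apply: le_trans (padic_absD _ _) _; rewrite ge_max !le_max lexx /=.
by rewrite IHs orbT.
Qed.

End PadicAbs.

Section Necessity.

Variables (gT : finGroupType) (r : nat) (a : 'I_r -> rat) (s : 'I_r -> gT) (x : gT -> rat).
Hypothesis x_neq0 : exists h, x h != 0.
Hypothesis ax : forall g, \sum_i a i * x (s i * g)%g = 0.

(** Translating the relation brings any [x h], in particular a largest one, into the position
    [i]. *)
Lemma relation_isolate i h : a i * x h = - \sum_(j | j != i) a j * x (s j * ((s i)^-1 * h))%g.
Proof.
have := ax ((s i)^-1 * h)%g; rewrite (bigD1 i) //= mulKVg => /eqP.
by rewrite addr_eq0 => /eqP.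
Qed.

Lemma relation_real_condition : real_condition a.
Proof.
move=> i; have [h0 xh0] := x_neq0.
case: (@arg_maxP _ _ gT h0 xpredT (fun g => `|x g|) isT) => h _ h_max.
have xh : 0 < `|x h| by apply: lt_le_trans (h_max h0 isT); rewrite normr_gt0.
rewrite -(ler_pM2r xh) -normrM relation_isolate normrN mulr_suml.
apply: le_trans (ler_norm_sum _ _ _) _; apply: ler_sum => j _.
rewrite normrM ler_wpM2l //; exact: h_max.
Qed.

Lemma relation_padic_condition : padic_condition a.
Proof.
move=> p p_prime i; have [h0 xh0] := x_neq0.
case: (@arg_maxP _ _ gT h0 xpredT (fun g => padic_abs p (x g)) isT) => h _ h_max.
have xh : 0 < padic_abs p (x h).
  by apply: lt_le_trans (h_max h0 isT); apply: padic_abs_gt0.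
rewrite -(ler_pM2r xh) -padic_absM // relation_isolate -sumrN.
apply: le_trans (padic_abs_sum p_prime _ _ _) _.
apply: bigmax_le => [|j ji].
  by apply: mulr_ge0; [apply: bigmax_ge_id | apply: ltW].
rewrite -mulrN padic_absM //.
apply: ler_pM; rewrite ?padic_abs_ge0 //; first exact: (@le_bigmax_cond _ _ _ 0 _ _ (fun j => padic_abs p (a j)) ji).
rewrite padic_absN; exact: h_max.
Qed.

End Necessity.

Lemma galois_relation_conditions (L : splittingFieldType rat) r (a : 'I_r -> rat)
    (theta : 'I_r -> L) :
    (forall i, theta i != 0) -> galois_conjugates theta -> \sum_(i < r) a i *: theta i = 0 ->
  padic_condition a /\ real_condition a.
Proof.
case: r => [|r] in a theta *; first by split=> [p _|] [].
move=> theta0 [t conj_t] a_theta.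
have [s sE] : exists s : 'I_r.+1 -> gal_of {:L}, forall i, theta i = s i t.
  apply: (@fin_all_exists _ (fun=> gal_of {:L}) (fun i g => theta i = g t)) => i.
  by have [g _ gE] := conj_t i; exists g.
have t0 : t != 0 by apply: contra (theta0 ord0) => /eqP t0; rewrite sE t0 rmorph0.
have [k tk] : exists k, coord (vbasis {:L}) k t != 0.
  apply/existsP; apply: contraNT t0; rewrite negb_exists => /forallP tk.
  rewrite (coord_vbasis (memvf t)) big1 // => k _.
  by have := tk k; rewrite negbK => /eqP->; rewrite scale0r.
(* A rational coordinate of the conjugates of [t], nonzero at the identity; applying [g] to the
   relation in [L] gives the relation for [x]. *)
pose x (h : gal_of {:L}) := coord (vbasis {:L}) k (h t).
have x0 : exists h, x h != 0 by exists 1%g; rewrite /x gal_id.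
have ax g : \sum_i a i * x (s i * g)%g = 0.
  transitivity (coord (vbasis {:L}) k (g (\sum_i a i *: theta i))).
    rewrite !linear_sum /=; apply: eq_bigr => i _.
    by rewrite !linearZ /= sE /x galM ?memvf.
  by rewrite a_theta !linear0.
split; [exact: relation_padic_condition x0 ax | exact: relation_real_condition x0 ax].
Qed.

(** * Sufficiency *)

Lemma Bezout_seq (I : eqType) (s : seq I) (b : I -> int) : uniq s ->
  exists2 g : int, {in s, forall i, (g %| b i)%Z} & exists u : I -> int, \sum_(i <- s) b i * u i = g.
Proof.
elim: s => [|i s IHs] /=; first by exists 0 => //; exists (fun=> 0); rewrite big_nil.
case/andP=> i_s /IHs[g g_dvd [u uE]].
have [v [c vcE]] := Bezoutz (b i) g.
exists (gcdz (b i) g) => [j|].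
  rewrite inE => /predU1P[->|j_s]; first exact: dvdz_gcdl.
  by apply: dvdz_trans (g_dvd j j_s); apply: dvdz_gcdr.
exists (fun j => if j == i then v else c * u j).
rewrite big_cons eqxx -vcE mulrC; congr (_ + _).
rewrite -uE mulr_sumr; apply: eq_big_seq => j j_s.
by case: eqP => [ji|_]; [rewrite -ji j_s in i_s | rewrite mulrCA].
Qed.

(** After clearing denominators, the condition at all primes says that the gcd of the other
    coefficients divides the [i]-th, and a Bezout relation gives the integral solution. *)
Lemma padic_condition_onto r (a : 'I_r -> rat) i : padic_condition a -> a i != 0 ->
  exists z : 'I_r -> rat, [/\ forall j, z j \is a Num.int, z i = 1 & \sum_j a j * z j = 0].
Proof.
move=> a_padic ai0; have [N N_gt0 NP] := common_denominator a.
have [b bE] : exists b : 'I_r -> int, forall j, a j *+ N = (b j)%:~R.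
  apply: (@fin_all_exists _ (fun=> int) (fun j q => a j *+ N = q%:~R)) => j.
  by have /intrP[q ->] := NP j; exists q.
have N0 : (N%:R : rat) != 0 by rewrite pnatr_eq0 -lt0n.
have aE j : a j = (b j)%:~R / (N%:Z)%:~R by rewrite -bE -(mulr_natr (a j)) mulfK.
have Nz : (Posz N == 0) = false by rewrite eqz_nat gtn_eqF.
have b0 j : (b j == 0) = (a j == 0).
  by rewrite -(intr_eq0 rat) -bE mulrn_eq0 (gtn_eqF N_gt0).
have [g g_dvd [u uE]] := @Bezout_seq _ [seq j <- enum 'I_r | j != i] b (filter_uniq _ (enum_uniq _)).
have near p : prime p -> exists j, [/\ j != i, a j != 0 & (logn p `|b j| <= logn p `|b i|)%N].
  move=> p_prime; have := a_padic p p_prime i.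
  have [/existsP[j /andP[ji le_ij]] _|/existsPn far] := boolP [exists j, (j != i) && (padic_abs p (a i) <= padic_abs p (a j))].
    have aj0 : a j != 0.
      apply: contraTneq le_ij => ->; rewrite {2}/padic_abs eqxx -ltNge.
      exact: padic_abs_gt0.
    exists j; split=> //; move: le_ij; rewrite padic_abs_le // !aE.
    by rewrite !padic_val_frac ?b0 ?Nz // lerD2r lez_nat.
  rewrite leNgt => /negP[]; apply: bigmax_lt => [|j ji]; first exact: padic_abs_gt0.
  by have := far j; rewrite ji /= -ltNge.
have g_dvd' j : j != i -> (g %| b j)%Z.
  by move=> ji; apply: g_dvd; rewrite mem_filter ji mem_enum.
(* Any prime would do here: only a nonzero coefficient other than [a i] is wanted. *)
have g0 : g != 0.
  have [j [ji aj0 _]] := near 2 isT.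
  by apply: contraTneq (g_dvd' j ji) => ->; rewrite dvd0z b0.
have bi_gt0 : (0 < `|b i|)%N by rewrite absz_gt0 b0.
have g_bi : (g %| b i)%Z.
  rewrite dvdzE; apply/dvdn_partP => [|p]; first by rewrite absz_gt0.
  rewrite mem_primes => /and3P[p_prime _ _]; rewrite p_part pfactor_dvdn //.
  have [j [ji aj0 le_ji]] := near p p_prime; apply: leq_trans le_ji.
  apply: dvdn_leq_log; first by rewrite absz_gt0 b0.
  by have := g_dvd' j ji; rewrite dvdzE.
have [q Dq] := dvdzP g_bi.
exists (fun j => if j == i then 1 else - (u j * q)%:~R); split=> [j||].
- by case: ifP => _; rewrite ?rpred1 // rpredN rpred_int.
- by rewrite eqxx.
rewrite (bigD1 i) //= eqxx mulr1.
have -> : \sum_(j | j != i) a j * (if j == i then 1 else - (u j * q)%:~R) =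
    - ((\sum_(j <- [seq j <- enum 'I_r | j != i]) b j * u j) * q)%:~R / N%:R.
  rewrite big_filter big_enum_cond /= mulr_suml rmorph_sum /= -sumrN mulr_suml.
  apply: eq_bigr => j /negPf->; rewrite aE !intrM -pmulrn; ring.
by rewrite uE [g * q]mulrC -Dq aE mulNr subrr.
Qed.

(** On two points with [x] equal to 1 and [-1], the transposition changes the sign. *)
Lemma degenerate_permuted r (a : 'I_r -> rat) (e : 'I_r -> bool) :
  \sum_i (-1) ^+ e i * a i = 0 -> permuted_relation a.
Proof.
move=> ae; exists 2, (fun i => if e i then tperm ord0 ord_max else 1%g).
exists (fun k => (-1) ^+ (k : nat)); split=> [|k]; first by exists ord0.
transitivity ((-1) ^+ (k : nat) * \sum_i (-1) ^+ e i * a i); last by rewrite ae mulr0.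
rewrite mulr_sumr; apply: eq_bigr => i _; rewrite mulrA mulrC; congr (_ * _).
case: (e i); last by rewrite perm1 mulr1.
have [->|->] : k = ord0 \/ k = ord_max by case: k => -[|[|k]] // lt_k; [left|right]; apply: val_inj.
  by rewrite tpermL.
by rewrite tpermR /= mulrN1 opprK.
Qed.

Lemma conditions_permuted r (a : 'I_r -> rat) :
  padic_condition a -> real_condition a -> permuted_relation a.
Proof.
move=> a_padic a_real.
have [/existsP[i0 ai0]|/existsPn a0] := boolP [exists i, a i != 0]; last first.
  apply: (degenerate_permuted (e := fun=> false)); apply: big1 => i _.
  by have := a0 i; rewrite negbK => /eqP->; rewrite mulr0.
case: (@arg_maxP _ _ _ i0 xpredT (fun i => `|a i|) isT) => i1 _ a_max.
have ai1 : a i1 != 0.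
  by rewrite -normr_gt0; apply: lt_le_trans (a_max i0 isT); rewrite normr_gt0.
have := a_real i1; rewrite le_eqVlt => /predU1P[a_eq|a_lt].
  apply: (degenerate_permuted (e := fun i => (i == i1) (+) (a i < 0))).
  rewrite (bigD1 i1) //= eqxx addTb signrN mulNr -normrEsign a_eq addrC.
  apply/eqP; rewrite subr_eq0; apply/eqP; apply: eq_bigr => j /negPf->.
  by rewrite addFb -normrEsign.
(* Zero coefficients are removed before the strict case applies; the largest one takes the place
   [None]. Removed indices later receive the identity permutation. *)
pose J := [pred j | (a j != 0) && (j != i1)]; pose f (k : 'I_#|J|) := enum_val k.
have fJ k : (a (f k) != 0) && (f k != i1) by apply: (enum_valP k).
pose emb (u : option 'I_#|J|) := if u is Some k then f k else i1.
have sumJ (F : 'I_r -> rat) : (forall j, a j = 0 -> F j = 0) -> \sum_j F j = \sum_u F (emb u).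
  move=> F0; rewrite big_option /= (bigD1 i1) //=; congr (_ + _).
  rewrite -(big_enum_val (A := J) F) /= (bigID (fun j => a j == 0)) /= big1 ?add0r.
    by apply: eq_bigl => j; rewrite andbC.
  by move=> j /andP[_ /eqP]; apply: F0.
have [||||N [s [x [x0 sx]]]] := @polygon_permuted _ (a \o emb).
- by case=> [k|] //=; have /andP[] := fJ k.
- by move=> k; apply: a_max.
- have := a_lt; congr (_ < _).
  have := sumJ (fun j => `|a j|); rewrite big_option /= (bigD1 i1) //= => E.
  by apply: (addrI `|a i1|); apply: E => j ->; rewrite normr0.
- move=> u; have aeu : a (emb u) != 0 by case: u => [k|] //=; have /andP[] := fJ k.
  have [z [z_int zu az]] := padic_condition_onto a_padic aeu.
  exists (z \o emb); split=> // [j|]; first exact: z_int.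
  by rewrite -[RHS]az (sumJ (fun j => a j * z j)) // => j ->; rewrite mul0r.
pose s' i := if i == i1 then s None else
  if [pick k | f k == i] is Some k then s (Some k) else 1%g.
have s'E u : s' (emb u) = s u.
  case: u => [k|] /=; rewrite /s' ?eqxx //; have /andP[_ /negPf->] := fJ k.
  case: pickP => [l /eqP/enum_val_inj-> //|/(_ k)].
  by rewrite eqxx.
exists N, s', x; split=> // k; rewrite (sumJ (fun i => a i * x (s' i k))) => [|j ->]; last by rewrite mul0r.
by rewrite -[RHS](sx k); apply: eq_bigr => u _; rewrite s'E.
Qed.

Lemma perm_widen N N' (le_N : (N <= N')%N) (s : 'S_N) :
  exists s' : 'S_N', forall k, s' (widen_ord le_N k) = widen_ord le_N (s k).
Proof.
pose g (s : 'S_N) (k : 'I_N') : 'I_N' :=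
  if insub (k : nat) is Some j then widen_ord le_N (s j) else k.
have gE t j : g t (widen_ord le_N j) = widen_ord le_N (t j).
  by rewrite /g /= valK.
have gK : cancel (g s) (g s^-1%g).
  move=> k; have [lt_k|le_k] := ltnP k N.
    have -> : k = widen_ord le_N (Ordinal lt_k) by apply: val_inj.
    by rewrite !gE permK.
  by rewrite /g; case: insubP => [j|]; rewrite ?insubN -?leqNgt // ltnNge le_k.
by exists (perm (can_inj gK)) => k; rewrite permE gE.
Qed.

Lemma permuted_galois r (a : 'I_r -> rat) : permuted_relation a ->
  exists L : splittingFieldType rat, galois 1 {:L} /\
    exists theta : 'I_r -> L, [/\ forall i, theta i != 0, galois_conjugates theta
      & \sum_(i < r) a i *: theta i = 0].
Proof.
case=> N [s [x [[k0 xk0] sx]]].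
have [M [lt_N [L [galL [al [al_inj al_real]]]]]] := symmetric_extension N.
have le_N := ltnW lt_N; pose w := widen_ord le_N.
have w_inj : injective w by move=> i j /(congr1 val)/= /val_inj.
pose t := \sum_k x k *: al (w k).
have t0 : t != 0.
  (* Exchanging the root of [k0] with the spare root [k1], absent from [t], changes [t] by a nonzero
     amount, so [t != 0]. *)
  pose k1 := Ordinal lt_N.
  have [g gG gE] := al_real (tperm (w k0) k1).
  have wk1 k : w k != k1 by rewrite -val_eqE /= ltn_eqF.
  have : t - g t = x k0 *: (al (w k0) - al k1).
    rewrite /t linear_sum -sumrB (bigD1 k0) //= linearZ /= gE tpermL -scalerBr.
    rewrite big1 ?addr0 // => k kk0; rewrite linearZ /= gE tpermD ?subrr //.
      by rewrite (inj_eq w_inj) eq_sym.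
    by rewrite eq_sym.
  apply: contra_eqN => /eqP->; rewrite rmorph0 subrr eq_sym scaler_eq0 (negPf xk0) /=.
  by rewrite subr_eq0 (inj_eq al_inj).
(* The inverse of [s i] moves the coefficient [x (s i k)] to the root indexed by [k], so every root
   receives a coefficient that vanishes by the relation. *)
have gP i : exists g : gal_of {:L}, g \in 'Gal({:L} / 1)%g /\ forall k, g (al (w k)) = al (w ((s i)^-1%g k)).
  have [s' s'E] := perm_widen le_N (s i)^-1%g.
  by have [g gG gE] := al_real s'; exists g; split=> // k; rewrite gE s'E.
have [g gE] := @fin_all_exists _ (fun=> gal_of {:L}) _ gP.
exists L; split=> //; exists (fun i => g i t); split=> [i||].
- by rewrite fmorph_eq0.
- by exists t => i; exists (g i) => //; have [] := gE i.
transitivity (\sum_i \sum_k (a i * x (s i k)) *: al (w k)).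
  apply: eq_bigr => i _; have [_ giE] := gE i.
  rewrite /t linear_sum scaler_sumr (reindex_inj (@perm_inj _ (s i))) /=.
  by apply: eq_bigr => k _; rewrite linearZ /= giE permK scalerA.
rewrite exchange_big big1 // => k _; rewrite -scaler_suml sx scale0r.
by [].
Qed.

Theorem theorem1p3 (r : nat) (a : 'I_r -> rat) :
  (exists L : splittingFieldType rat,
     galois 1 {:L} /\
     exists theta : 'I_r -> L,
       [/\ forall i : 'I_r, theta i != 0,
           galois_conjugates theta
         & \sum_(i < r) a i *: theta i = 0])
  <-> (padic_condition a /\ real_condition a).
Proof.
split=> [[L [_ [theta [theta0 conj_theta a_theta]]]]|[a_padic a_real]].
  exact: galois_relation_conditions theta0 conj_theta a_theta.
exact/permuted_galois/conditions_permuted.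
Qed.
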